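(* Let $(X,Y)$ be a random pair in $\mathcal X\times\mathbb R$ with $|Y|\le b$ a.s. for some $b>0$, let $\mathcal D=\{(X_1,Y_1),\dots,(X_n,Y_n)\}$ consist of $n$ i.i.d. copies of $(X,Y)$, and let $\mathcal F=\{f_1,\dots,f_M\}$ be a finite dictionary of deterministic measurable functions $\mathcal X\to\mathbb R$ with $\max_{1\le j\le M}|f_j(X)|\le b$ a.s. Suppose the loss $\ell$ satisfies Assumption 1 with constants $C_b$ and $C_\ell$. Let $\nu\in(0,1)$, let $\pi=(\pi_1,\dots,\pi_M)$ be a prior with $\pi_j>0$ and $\sum_j\pi_j=1$, set $\mu=\min(\nu,1-\nu)\,C_\ell/10$, and let $\beta$ satisfy $$\beta>\max\Big[\frac{12C_b^2(1-\nu)^2}{\mu},\ 6\sqrt3\,bC_b(1-\nu),\ \frac{3C_b\nu(\nu C_b+4\mu b)}{2\mu}\Big].$$ Let $\hat\theta$ be the $Q$-aggregation weight vector defined below. Then for every $x>0$, with probability at least $1-e^{-x}$, $$R(f_{\hat\theta})\le\min_{1\le j\le M}\Big[R(f_j)+\frac{\beta}{n}\log\frac1{\pi_j}\Big]+\frac{2\beta x}{n},$$ and moreover $$\mathbb E\big[R(f_{\hat\theta})\big]\le\min_{1\le j\le M}\Big[R(f_j)+\frac{\beta}{n}\log\frac1{\pi_j}\Big].$$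
   Context: Loss $\ell:\mathbb R^2\to\mathbb R$. For a (possibly data-dependent) function $f:\mathcal X\to\mathbb R$, the risk is $R(f)=\mathbb E[\ell(Y,f(X))\mid\mathcal D]$ (where $(X,Y)$ is independent of $\mathcal D$), and the empirical risk is $R_n(f)=\frac1n\sum_{i=1}^n\ell(Y_i,f(X_i))$. $\Theta=\{\theta\in\mathbb R^M:\theta_j\ge0,\ \sum_{j=1}^M\theta_j=1\}$ and $f_\theta=\sum_{j=1}^M\theta_jf_j$. Assumption 1: for all $f,g\in[-b,b]$, $|\ell(Y,f)-\ell(Y,g)|\le C_b|f-g|$ almost surely; and almost surely the function $\ell(Y,\cdot)$ is strongly convex on $[-b,b]$ with modulus $C_\ell>0$, i.e. $\ell(Y,\alpha a+(1-\alpha)a')\le\alpha\ell(Y,a)+(1-\alpha)\ell(Y,a')-\frac{C_\ell}{2}\alpha(1-\alpha)(a-a')^2$ for all $a,a'\in[-b,b]$, $\alpha\in(0,1)$. $Q$-aggregation: $\hat\theta$ is any (measurable) minimizer over $\Theta$ of $$\theta\mapsto(1-\nu)R_n(f_\theta)+\nu\sum_{j=1}^M\theta_jR_n(f_j)-\frac{\beta}{n}\sum_{j=1}^M\theta_j\log\pi_j .$$ *)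

(* Defs.v *)
From HB Require Import structures.
From mathcomp Require Import all_boot all_order all_algebra.
From mathcomp Require Import all_classical all_reals all_analysis.
Set Implicit Arguments. Unset Strict Implicit. Unset Printing Implicit Defensive.
Import Order.TTheory GRing.Theory Num.Theory.
Local Open Scope classical_set_scope.
Local Open Scope ring_scope.

(* Mutual independence of a finite family of random elements Z_i : Omega -> T
   (product rule over every family of measurable events; taking A_i = setT for
   unused indices gives the product rule for every subfamily). *)
Definition mutually_independent {R : realType} {dO d : measure_display}
  {Omega : measurableType dO} {T : measurableType d}
  (P : probability Omega R) (n : nat) (Z : 'I_n -> Omega -> T) : Prop :=
  forall A : 'I_n -> set T, (forall i, measurable (A i)) ->
    P (\bigcap_(i in [set: 'I_n]) (Z i @^-1` A i)) =
    (\prod_(i < n) P (Z i @^-1` A i))%E.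

Definition iid_sample {R : realType} {dO d : measure_display}
  {Omega : measurableType dO} {T : measurableType d}
  (P : probability Omega R) (law : probability T R) (n : nat)
  (Z : 'I_n -> Omega -> T) : Prop :=
  (forall i, measurable_fun setT (Z i)) /\
  (forall i (A : set T), measurable A -> P (Z i @^-1` A) = law A) /\
  mutually_independent P Z.

Definition simplex {R : realType} (M : nat) (theta : 'I_M -> R) : Prop :=
  (forall j, 0 <= theta j) /\ \sum_(j < M) theta j = 1.

Definition mix {R : realType} {X : Type} (M : nat) (f : 'I_M -> X -> R)
  (theta : 'I_M -> R) : X -> R := fun x => \sum_(j < M) theta j * f j x.

(* Risk of a (fixed) function g : X -> R, i.e. E[l(Y, g(X))] where (X,Y) ~ law.
   For the data-dependent f_thetahat this is evaluated at the realized thetahat,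
   which is E[l(Y, f_thetahat(X)) | D] for (X,Y) independent of D. *)
Definition risk {R : realType} {d : measure_display} {X : measurableType d}
  (law : probability (X * R)%type R) (l : R -> R -> R) (g : X -> R) : \bar R :=
  (\int[law]_z (l z.2 (g z.1))%:E)%E.

Definition emp_risk {R : realType} {X : Type} (n : nat) (data : 'I_n -> X * R)
  (l : R -> R -> R) (g : X -> R) : R :=
  n%:R^-1 * \sum_(i < n) l (data i).2 (g (data i).1).

Definition Qcrit {R : realType} {X : Type} (n M : nat) (data : 'I_n -> X * R)
  (l : R -> R -> R) (f : 'I_M -> X -> R) (nu beta : R) (pi : 'I_M -> R)
  (theta : 'I_M -> R) : R :=
  (1 - nu) * emp_risk data l (mix f theta)
  + nu * \sum_(j < M) theta j * emp_risk data l (f j)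
  - beta / n%:R * \sum_(j < M) theta j * ln (pi j).

(* Main.v *)
(* Let psi_theta be the interpolated loss (1-nu) l(f_theta) + nu sum_j theta_j l(f_j)
   and theta* the minimizer over the simplex of its mean, penalized by the prior and
   by a multiple of the spread sum_j theta_j |f_j - f_theta|^2. Strong convexity gives
   quadratic growth around theta*, so that the excess risk of thetahat is at most
   twice the increment at thetahat of the empirical process of psi_theta, minus
   quadratic terms and minus (beta/n) sum_j thetahat_j log(1/pi_j).
   The exponential moment of this random variable, at scale n/beta, is at most 1.
   It is split by convexity, with weights 3/8 and 5/8, into the part of the process
   that is nonlinear in theta and the part that is linear in theta. The linear part is
   dominated by the vertices of the simplex, where Bernstein's inequality applies. The
   nonlinear part is discretized over a finite net of the simplex, symmetrized and
   contracted (Ledoux-Talagrand) one observation at a time, which makes it linear as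
   well. In both parts the prior makes the sum over the vertices at most 1.
   The second condition on beta is implied by the first one, up to the better constant
   108 b Cb (1-nu), because 9 Cl b <= 10 Cb. *)
Require Import Defs.
From HB Require Import structures.
From mathcomp Require Import all_boot all_order all_algebra.
From mathcomp Require Import all_classical all_reals all_analysis.
From mathcomp Require Import measurable_realfun ring lra.
Set Implicit Arguments.
Unset Strict Implicit.
Unset Printing Implicit Defensive.
Import Order.TTheory GRing.Theory Num.Theory.
Import numFieldNormedType.Exports.
Local Open Scope classical_set_scope.
Local Open Scope ring_scope.

(** * Bounds on the exponential *)

Section exp_bounds.
Context {R : realType}.
Implicit Types (x y c : R).

(** The obstacle is that [thetahat] ranges over a continuum, while only the prior on the vertices
    can pay for the supremum. A process linear in theta is harmless: the exponential of an average
    is at most the sum over the vertices, however many weight vectors compete. This is what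
    contraction is for, and why the cardinality of the net never enters a bound. Constants: let p be
    the weight of the nonlinear part in the convex split and k mu the weight of the spread in the
    objective of theta*. The quadratic terms leave (5 - 3k) mu for the nonlinear part and 2k mu for
    the linear one. To leading order, the condition on beta with 12 Cb^2 (1-nu)^2 asks for 5 - 3k >=
    2/(3p), and the one with 3 Cb nu asks for k >= 2/(3(1-p)). Some k satisfies both iff 2/(1-p) +
    2/(3p) <= 5. The left side has minimum about 4.976, near p = 0.366; p = 3/8 is a nearby
    rational, with k = 16/15, and the small slack left absorbs the fourth-order term of cosh. *)

Lemma leq_fact_expn m k : (m`! * m.+1 ^ k <= (m + k)`!)%N.
Proof.
elim: k => [|k IH]; first by rewrite expn0 muln1 addn0.
rewrite expnS mulnCA addnS factS.
exact: leq_mul (leq_addr _ _) IH.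
Qed.

Lemma geometric_sum_le (q : R) N : 0 <= q < 1 ->
  \sum_(0 <= k < N) q ^+ k <= (1 - q)^-1.
Proof.
move=> /andP[q0 q1]; have h : 0 < 1 - q by rewrite subr_gt0.
rewrite -[leRHS]mul1r ler_pdivlMr//.
suff -> : (\sum_(0 <= k < N) q ^+ k) * (1 - q) = 1 - q ^+ N.
  by rewrite lerBlDr lerDl exprn_ge0.
elim: N => [|N IH]; first by rewrite big_geq// mul0r expr0 subrr.
by rewrite big_nat_recr//= mulrDl IH exprSr; ring.
Qed.

(** Beyond order [m] each new factor of the factorial is at least [m + 1], so the remainder is
    dominated by a geometric series of ratio [c / (m + 1)]. Order 2 gives Bernstein's denominator
    [1 - c / 3], order 4 the bound on cosh. *)
Lemma expR_taylor_le (m : nat) x c : `|x| <= c -> c < m.+1%:R ->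
  expR x <= \sum_(0 <= k < m) x ^+ k / k`!%:R
            + `|x| ^+ m / m`!%:R / (1 - c / m.+1%:R).
Proof.
move=> xc cm.
have m0 : 0 < m.+1%:R :> R by rewrite ltr0n.
have c0 : 0 <= c by apply: le_trans xc.
have q0 : 0 <= c / m.+1%:R < 1.
  by apply/andP; split; [rewrite divr_ge0|rewrite ltr_pdivrMr// mul1r].
have cst0 : 0 <= `|x| ^+ m / m`!%:R by rewrite divr_ge0// exprn_ge0.
have tail N : \sum_(0 <= k < N) x ^+ (m + k) / (m + k)`!%:R
    <= `|x| ^+ m / m`!%:R / (1 - c / m.+1%:R).
  apply: le_trans (ler_wpM2l cst0 (geometric_sum_le N q0)).
  rewrite mulr_sumr ler_sum// => k _.
  apply: (@le_trans _ _ (`|x| ^+ (m + k) / (m + k)`!%:R)).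
    by rewrite ler_wpM2r ?invr_ge0// -normrX ler_norm.
  have -> : `|x| ^+ m / m`!%:R * (c / m.+1%:R) ^+ k =
      (`|x| ^+ m * c ^+ k) * (m`! * m.+1 ^ k)%:R^-1.
    by rewrite natrM natrX expr_div_n invfM; ring.
  rewrite exprD; apply: ler_pM.
  - by rewrite mulr_ge0// exprn_ge0.
  - by rewrite invr_ge0.
  - by rewrite ler_wpM2l ?exprn_ge0// lerXn2r// nnegrE.
  - rewrite lef_pV2 ?posrE ?ltr0n ?muln_gt0 ?fact_gt0 ?expn_gt0//.
    by rewrite ler_nat leq_fact_expn.
rewrite [expR x]/expR; apply: limr_le; first exact: is_cvg_series_exp_coeff.
near=> N.
have mN : (m <= N)%N by near: N; exact: nbhs_infty_ge.
rewrite /series/= (big_cat_nat (n := m))//= lerD//.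
rewrite -[X in index_iota X _]add0n big_addn.
apply: le_trans (tail (N - m)%N).
rewrite le_eqVlt; apply/orP; left; apply/eqP; apply: eq_bigr => i _.
by rewrite addnC.
Unshelve. all: by end_near. Qed.

Lemma expR_bernstein x c : `|x| <= c -> c < 3 ->
  expR x <= 1 + x + x ^+ 2 / (2 * (1 - c / 3)).
Proof.
move=> xc c3; apply: le_trans (expR_taylor_le (m := 2) xc c3) _.
rewrite big_nat_recr//= big_nat1 expr0 expr1 fact0 (_ : 1`! = 1)%N// !divr1.
by rewrite (_ : 2`! = 2)%N// real_normK ?num_real// invfM mulrA.
Qed.

(** The odd terms cancel, and on arguments of size at most 1/5 the fourth-order term is a small
    fraction of the second-order one. The factor [1 + 1/200] is a loss that the constants of the
    theorem can absorb. *)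
Lemma cosh_le y : `|y| <= 1 / 5 ->
  (expR y + expR (- y)) / 2 <= 1 + y ^+ 2 / 2 * (1 + 1 / 200).
Proof.
move=> y5; have c5 : 1 / 5 < 4.+1%:R :> R by lra.
(* 25/576 is 1/24 divided by [1 - (1/5) / 5]. *)
have h (z : R) : `|z| <= 1 / 5 -> expR z <= 1 + z + z ^+ 2 / 2 + z ^+ 3 / 6
    + z ^+ 4 * (25 / 576).
  move=> /expR_taylor_le/(_ c5).
  rewrite 3?big_nat_recr//= big_nat1 expr0 expr1 fact0 (_ : 1`! = 1)%N//.
  rewrite (_ : 2`! = 2)%N// (_ : 3`! = 6)%N// (_ : 4`! = 24)%N//.
  have -> : `|z| ^+ 4 = z ^+ 4 by rewrite -normrX ger0_norm// exprn_even_ge0.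
  move=> /le_trans; apply; rewrite le_eqVlt; apply/orP; left; apply/eqP.
  by field.
have h1 := h _ y5; have := h (- y); rewrite normrN => /(_ y5) h2.
have y2 : y ^+ 2 <= 1 / 25.
  rewrite -real_normK ?num_real//; have := normr_ge0 y; nra.
have y4 : y ^+ 4 <= 1 / 25 * y ^+ 2.
  have -> : y ^+ 4 = y ^+ 2 * y ^+ 2 by rewrite -exprD.
  by rewrite ler_wpM2r ?sqr_ge0.
have e2 : (- y) ^+ 2 = y ^+ 2 by ring.
have e3 : (- y) ^+ 3 = - y ^+ 3 by ring.
have e4 : (- y) ^+ 4 = y ^+ 4 by ring.
rewrite e2 e3 e4 in h2.
have y20 := sqr_ge0 y.
lra.
Qed.

(* A two-point form of the Ledoux-Talagrand contraction principle. *)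
Lemma expR_contraction2 (a c p q u v : R) :
  `|p| <= `|u| -> `|q| <= `|v| -> `|p - q| <= `|u - v| ->
  expR (a + p) + expR (c - q) <=
  Num.max (expR (a + u)) (expR (c + v)) + Num.max (expR (a - u)) (expR (c - v)).
Proof.
wlog u0 : u v / 0 <= u.
  move=> H; case: (leP 0 u) => [u0|u0 hp hq hpq]; first exact: H.
  rewrite [leRHS]addrC.
  have := H (- u) (- v); rewrite oppr_ge0 !normrN -opprD normrN => /(_ (ltW u0)).
  by rewrite !opprK; exact.
rewrite (ger0_norm u0) => /ler_normlP[p1 p2].
have E (w1 w2 : R) : w1 <= w2 -> expR w1 <= expR w2 by rewrite ler_expR.
(* For opposite signs the two exponentials are bounded separately, by those of [a + u] and
   [c - v]. *)
have [v0|v0] := leP 0 v; last first.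
  rewrite (ltr0_norm v0) => /ler_normlP[q1 q2] _; apply: lerD.
    by rewrite le_max E//; lra.
  by rewrite le_max orbC E//; lra.
rewrite (ger0_norm v0) => /ler_normlP[q1 q2].
(* for increasing increments, exp magnifies the larger one at a higher base *)
have slide (w1 w2 d1 d2 : R) : 0 <= d1 -> d1 <= d2 -> w1 <= w2 ->
    expR (w1 + d1) + expR w2 <= expR w1 + expR (w2 + d2).
  move=> d10 d12 w12.
  suff : expR w1 * (expR d1 - 1) <= expR w2 * (expR d2 - 1) by rewrite !expRD; lra.
  apply: ler_pM.
  - exact: expR_ge0.
  - by rewrite subr_ge0 -expR0 E.
  - exact: E.
  - by rewrite lerD2r E.
have M1 (x y : R) : x <= Num.max x y by rewrite le_max lexx.
have M2 (x y : R) : y <= Num.max x y by rewrite le_max lexx orbT.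
(* For equal signs there are two ways out: either [slide] moves the increment of the index with the
   smaller slope onto the higher exponent, or both exponentials on the left are dominated by the two
   signs of one and the same index. *)
case: (leP v u) => uv.
  rewrite (@ger0_norm _ (u - v)) ?subr_ge0// => /ler_normlP[h1 h2].
  case: (leP (c - v) (a + p)) => h.
    have := slide (c - v) (a + p) (v - q) (u - p).
    rewrite (_ : c - v + (v - q) = c - q); last ring.
    rewrite (_ : a + p + (u - p) = a + u); last ring.
    have := M1 (expR (a + u)) (expR (c + v)).
    have := M2 (expR (a - u)) (expR (c - v)).
    by move=> ? ? /(_ _ _ h) k; have := k ltac:(lra) ltac:(lra); lra.
  rewrite addrC; apply: lerD; rewrite le_max; apply/orP; right; apply: E; lra.
rewrite (@ltr0_norm _ (u - v)) ?subr_lt0// => /ler_normlP[h1 h2].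
case: (leP (a - u) (c - q)) => h.
  have := slide (a - u) (c - q) (p + u) (v + q).
  rewrite (_ : a - u + (p + u) = a + p); last ring.
  rewrite (_ : c - q + (v + q) = c + v); last ring.
  have := M2 (expR (a + u)) (expR (c + v)).
  have := M1 (expR (a - u)) (expR (c - v)).
  by move=> ? ? /(_ _ _ h) k; have := k ltac:(lra) ltac:(lra); lra.
apply: lerD; rewrite le_max; apply/orP; left; apply: E; lra.
Qed.

End exp_bounds.

(** * Bounded measurable functions *)

Section bounded_measurable.
Context d (T : measurableType d) {R : realType}.
Implicit Types F G : T -> R.

(** Boundedness everywhere, not almost everywhere: the class is closed under the algebraic
    operations and the exponential, and linearity and monotonicity of the integral then need no
    further integrability argument. *)
Definition bmeas F := measurable_fun setT F /\ exists B, forall x, `|F x| <= B.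

Lemma bmeas_cst (c : R) : bmeas (fun=> c).
Proof. by split=> //; exists `|c|. Qed.

Lemma bmeasD F G : bmeas F -> bmeas G -> bmeas (fun x => F x + G x).
Proof.
move=> [mF [B hB]] [mG [C hC]]; split; first exact: measurable_funD.
by exists (B + C) => x; rewrite (le_trans (ler_normD _ _))// lerD.
Qed.

Lemma bmeasM F G : bmeas F -> bmeas G -> bmeas (fun x => F x * G x).
Proof.
move=> [mF [B hB]] [mG [C hC]]; split; first exact: measurable_funM.
by exists (B * C) => x; rewrite normrM ler_pM.
Qed.

Lemma bmeasZ (c : R) F : bmeas F -> bmeas (fun x => c * F x).
Proof. exact/bmeasM/bmeas_cst. Qed.

Lemma bmeasN F : bmeas F -> bmeas (fun x => - F x).
Proof.
move=> [mF [B hB]]; split; first exact: measurable_funN.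
by exists B => x; rewrite normrN.
Qed.

Lemma bmeasB F G : bmeas F -> bmeas G -> bmeas (fun x => F x - G x).
Proof. by move=> bF bG; apply/bmeasD => //; exact: bmeasN. Qed.

Lemma bmeasX F n : bmeas F -> bmeas (fun x => F x ^+ n).
Proof.
move=> bF; elim: n => [|n IH]; first exact: bmeas_cst.
by under eq_fun do rewrite exprS; exact: bmeasM.
Qed.

Lemma bmeas_sum (I : Type) (r : seq I) (F : I -> T -> R) :
  (forall i, bmeas (F i)) -> bmeas (fun x => \sum_(i <- r) F i x).
Proof.
move=> bF; elim: r => [|i r IH].
  by under eq_fun do rewrite big_nil; exact: bmeas_cst.
by under eq_fun do rewrite big_cons; exact: bmeasD.
Qed.

Lemma bmeas_expR F : bmeas F -> bmeas (fun x => expR (F x)).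
Proof.
move=> [mF [B hB]]; split; first exact: (measurableT_comp (@measurable_expR R)).
exists (expR B) => x.
by rewrite ger0_norm ?expR_ge0// ler_expR (le_trans (ler_norm _)).
Qed.

Variable mu : probability T R.

Lemma bmeas_integrable F : bmeas F -> mu.-integrable setT (EFin \o F).
Proof.
move=> [mF [B hB]]; apply: measurable_bounded_integrable => //.
  by rewrite -ge0_fin_numE// fin_num_measure.
exists B; split; first exact: num_real.
by move=> M BM x _ /=; apply: le_trans (hB x) (ltW BM).
Qed.

Lemma bmeas_RintegralE F : bmeas F ->
  (\int[mu]_x (F x)%:E = (\int[mu]_x F x)%:E)%E.
Proof.
by move=> bF; rewrite /Rintegral fineK// integrable_fin_num//; exact: bmeas_integrable.
Qed.

Lemma Rintegral_prob_cst (c : R) : \int[mu]_x c = c.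
Proof.
rewrite Rintegral_cst// (_ : fine _ = 1) ?mulr1//.
by have /(congr1 fine) := probability_setT mu.
Qed.

Lemma integral_prob_cst (c : \bar R) : (\int[mu]_x c = c)%E.
Proof. by rewrite -[RHS]mule1 -(@probability_setT _ _ _ mu) -integral_cst. Qed.

Lemma bmeas_RintegralD F G : bmeas F -> bmeas G ->
  \int[mu]_x (F x + G x) = \int[mu]_x F x + \int[mu]_x G x.
Proof. by move=> bF bG; rewrite RintegralD//; exact: bmeas_integrable. Qed.

Lemma bmeas_RintegralB F G : bmeas F -> bmeas G ->
  \int[mu]_x (F x - G x) = \int[mu]_x F x - \int[mu]_x G x.
Proof. by move=> bF bG; rewrite RintegralB//; exact: bmeas_integrable. Qed.

Lemma bmeas_RintegralZ (c : R) F : bmeas F ->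
  \int[mu]_x (c * F x) = c * \int[mu]_x F x.
Proof. by move=> bF; rewrite RintegralZl//; exact: bmeas_integrable. Qed.

Lemma bmeas_Rintegral_sum (I : Type) (r : seq I) (F : I -> T -> R) :
  (forall i, bmeas (F i)) ->
  \int[mu]_x (\sum_(i <- r) F i x) = \sum_(i <- r) \int[mu]_x F i x.
Proof.
move=> bF; elim: r => [|i r IH].
  by rewrite big_nil; under eq_Rintegral do rewrite big_nil; exact: Rintegral_prob_cst.
rewrite big_cons -IH; under eq_Rintegral do rewrite big_cons.
by rewrite bmeas_RintegralD//; exact: bmeas_sum.
Qed.

Lemma bmeas_le_Rintegral F G : bmeas F -> bmeas G -> (forall x, F x <= G x) ->
  \int[mu]_x F x <= \int[mu]_x G x.
Proof. by move=> bF bG FG; apply: le_Rintegral => //; exact: bmeas_integrable. Qed.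

(* The tangent at the mean m of F: exp y >= exp m * (1 + y - m). *)
Lemma expR_jensen F : bmeas F ->
  expR (\int[mu]_x F x) <= \int[mu]_x expR (F x).
Proof.
move=> bF; set m := \int[mu]_x F x.
have bL : bmeas (fun x => expR m * (1 - m) + expR m * F x).
  exact: (bmeasD (bmeas_cst (expR m * (1 - m))) (bmeasZ (expR m) bF)).
have -> : expR m = \int[mu]_x (expR m * (1 - m) + expR m * F x).
  rewrite (bmeas_RintegralD (bmeas_cst _) (bmeasZ (expR m) bF)).
  by rewrite (bmeas_RintegralZ _ bF) Rintegral_prob_cst -/m; ring.
apply: bmeas_le_Rintegral => // [|x]; first exact: bmeas_expR.
have := expR_ge1Dx (F x - m); rewrite expRB ler_pdivlMr ?expR_gt0//; lra.
Qed.

End bounded_measurable.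
Arguments bmeas_cst {d T R}.

(** * Symmetrization and contraction *)

Section contractible_functionals.
Context d (T : measurableType d) {R : realType} (mu : probability T R).
Variable S : finType.
Implicit Types (h : S -> R) (Psi : (S -> R) -> \bar R).

(* The properties of h |-> max_s exp (h s) used by symmetrization and contraction.
   They are stable under averaging over signs and observations, so that the two
   steps can be carried out for one observation at a time. *)
Record contractible Psi : Prop := Contractible {
  contractible_ge0 : forall h, (0 <= Psi h)%E ;
  contractible_measurable : forall d' (U : measurableType d') (H : S -> U -> R),
    (forall s, measurable_fun setT (H s)) ->
    measurable_fun setT (fun u => Psi (fun s => H s u)) ;
  contractible_jensen : forall h (G : S -> T -> R),
    (forall s, bmeas (G s)) ->
    (Psi (fun s => h s + \int[mu]_x G s x)%R
       <= \int[mu]_x Psi (fun s => h s + G s x)%R)%E ;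
  contractible_midpoint : forall h1 h2,
    (Psi (fun s => (h1 s + h2 s) / 2)%R <= 2^-1%:E * (Psi h1 + Psi h2))%E ;
  contractible_contract : forall h (p t : S -> R),
    (forall s, `|p s| <= `|t s|) ->
    (forall s s', `|p s - p s'| <= `|t s - t s'|) ->
    (Psi (fun s => h s + p s)%R + Psi (fun s => h s - p s)%R
      <= Psi (fun s => h s + t s)%R + Psi (fun s => h s - t s)%R)%E }.

(** The default 0 lies below every exponential and is the value for empty [S]. *)
Definition expmax h : R := \big[Num.max/0]_s expR (h s).

(* [radexp t k h] is the expectation of max_s exp (h s + sum_(i < k) e_i t_s(x_i)) over
   independent signs e_i and points x_i of law mu. *)
Fixpoint radexp (t : S -> T -> R) k h : \bar R :=
  if k is k'.+1 then
    (\int[mu]_x (2^-1%:E * (radexp t k' (fun s => h s + t s x)%R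
                          + radexp t k' (fun s => h s - t s x)%R)))%E
  else (expmax h)%:E.

Lemma expmax_ge0 h : 0 <= expmax h.
Proof. by rewrite /expmax; elim/big_ind: _ => // x y *; rewrite le_max; apply/orP; left. Qed.

Lemma le_expmax h s : expR (h s) <= expmax h.
Proof. exact: (le_bigmax 0 (fun s => expR (h s))). Qed.

Lemma expmax_le h K : 0 <= K -> (forall s, expR (h s) <= K) -> expmax h <= K.
Proof. by move=> K0 hK; apply: bigmax_le. Qed.

Lemma measurable_expmax d' (U : measurableType d') (H : S -> U -> R) :
  (forall s, measurable_fun setT (H s)) ->
  measurable_fun setT (fun u => expmax (fun s => H s u)).
Proof.
move=> mH; rewrite /expmax; elim: (index_enum S) => [|s r IH].
  by under eq_fun do rewrite big_nil; exact: measurable_cst.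
under eq_fun do rewrite big_cons.
apply: measurable_maxr => //.
by apply: measurableT_comp => //; exact: measurable_expR.
Qed.

(** For contraction, the maxima of the two signs are attained at some [s1] and [s2], and the
    two-point inequality applies to this pair; this is where the condition on differences
    [p s - p s'] is consumed. The midpoint property is the arithmetic-geometric mean inequality. *)
Lemma contractible_expmax : contractible (fun h => (expmax h)%:E).
Proof.
split.
- by move=> h; rewrite lee_fin expmax_ge0.
- by move=> d' U H mH; apply/measurable_EFinP; exact: measurable_expmax.
- move=> h G bG.
  have bhG s : bmeas (fun x => h s + G s x).
    exact: (bmeasD (bmeas_cst (h s)) (bG s)).
  rewrite {1}/expmax; elim/big_ind: _ => [|x y hx hy|s _].
  + by apply: integral_ge0 => x _; rewrite lee_fin expmax_ge0.
  + by rewrite EFin_max ge_max hx hy.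
  rewrite -{1}(Rintegral_prob_cst mu (h s)) -bmeas_RintegralD//; last exact: bmeas_cst.
  apply: (@le_trans _ _ (\int[mu]_x expR (h s + G s x))%:E).
    by rewrite lee_fin expR_jensen.
  rewrite -bmeas_RintegralE; last exact: bmeas_expR.
  apply: ge0_le_integral => //.
  + by apply/measurable_EFinP; exact: (bmeas_expR (bhG s)).1.
  + by apply/measurable_EFinP; exact: (measurable_expmax (fun s' => (bhG s').1)).
  + by move=> x _; rewrite lee_fin (le_expmax (fun s => h s + G s x)).
- move=> h1 h2; rewrite -EFinD -EFinM lee_fin; apply: expmax_le => [|s].
    by rewrite mulr_ge0 ?addr_ge0 ?expmax_ge0.
  have h : expR ((h1 s + h2 s) / 2) <= 2^-1 * (expR (h1 s) + expR (h2 s)).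
    have e1 : expR (h1 s) = expR (h1 s / 2) ^+ 2 by rewrite -expRM_natr; congr expR; field.
    have e2 : expR (h2 s) = expR (h2 s / 2) ^+ 2 by rewrite -expRM_natr; congr expR; field.
    by rewrite mulrDl expRD e1 e2; have := sqr_ge0 (expR (h1 s / 2) - expR (h2 s / 2)); lra.
  have := le_expmax h1 s; have := le_expmax h2 s; lra.
- move=> h p t pt pt2; rewrite -!EFinD lee_fin.
  case: (pickP (xpredT : pred S)) => [s0 _|noS]; last first.
    by rewrite /expmax !(big_pred0 _ _ _ _ noS).
  have arg q : exists s, expmax (fun s => h s + q s) = expR (h s + q s).
    rewrite /expmax (@bigmax_eq_arg _ _ _ 0 s0)//; first by eexists; reflexivity.
  have [s1 ->] := arg p; have [s2 ->] := arg (fun s => - p s).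
  apply: le_trans (expR_contraction2 _ _ (pt s1) (pt s2) (pt2 s1 s2)) _.
  apply: lerD; rewrite ge_max; apply/andP; split.
  + exact: (le_expmax (fun s => h s + t s)).
  + exact: (le_expmax (fun s => h s + t s)).
  + exact: (le_expmax (fun s => h s - t s)).
  + exact: (le_expmax (fun s => h s - t s)).
Qed.

End contractible_functionals.

(** * Averaging over one sign and one observation *)

Section rademacher_step.
Context d (T : measurableType d) {R : realType} (mu : probability T R).
Variable S : finType.
Implicit Types (h : S -> R) (Psi : (S -> R) -> \bar R) (g t : S -> T -> R).

Let half0 : (0 <= 2^-1 :> R). Proof. by rewrite invr_ge0. Qed.
Let half0E : (0 <= 2^-1%:E :> \bar R)%E. Proof. by rewrite lee_fin. Qed.

Definition symm Psi t h x : \bar R :=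
  (2^-1%:E * (Psi (fun s => h s + t s x)%R + Psi (fun s => h s - t s x)%R))%E.

Section props.
Variable Psi : (S -> R) -> \bar R.
Hypothesis cPsi : contractible mu Psi.

Lemma symm_ge0 t h x : (0 <= symm Psi t h x)%E.
Proof. by rewrite mule_ge0// adde_ge0//; exact: contractible_ge0 cPsi _. Qed.

Lemma measurable_symm d' (U : measurableType d') (H t : S -> U -> R) :
  (forall s, measurable_fun setT (H s)) -> (forall s, measurable_fun setT (t s)) ->
  measurable_fun setT
    (fun u => 2^-1%:E * (Psi (fun s => H s u + t s u)%R
                         + Psi (fun s => H s u - t s u)%R))%E.
Proof.
move=> mH mt; apply: emeasurable_funM; first exact: measurable_cst.
apply: emeasurable_funD.
  by apply: (contractible_measurable cPsi (H := fun s u => H s u + t s u)) => s;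
    exact: measurable_funD.
by apply: (contractible_measurable cPsi (H := fun s u => H s u - t s u)) => s;
  exact: measurable_funB.
Qed.

Lemma measurable_symm_pair d' (U : measurableType d') (H : S -> U -> R) t :
  (forall s, measurable_fun setT (H s)) -> (forall s, measurable_fun setT (t s)) ->
  measurable_fun setT (fun p : U * T => symm Psi t (fun s => H s p.1) p.2).
Proof.
move=> mH mt.
apply: (measurable_symm (H := fun s p => H s p.1) (t := fun s p => t s p.2)) => s.
  exact: measurableT_comp (mH s) measurable_fst.
exact: measurableT_comp (mt s) measurable_snd.
Qed.

Lemma measurable_symm1 h t : (forall s, measurable_fun setT (t s)) ->
  measurable_fun setT (symm Psi t h).
Proof. by move=> mt; exact: (measurable_symm (H := fun s _ => h s)). Qed.

(** Each property holds for fixed [x] and fixed sign, since a shift by [t] commutes with the other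
    additions, and it survives integration. Jensen's inequality also needs Tonelli to exchange the
    two integrals. Values in the extended reals make finiteness irrelevant. *)
Lemma contractible_symm t : (forall s, measurable_fun setT (t s)) ->
  contractible mu (fun h => \int[mu]_x symm Psi t h x)%E.
Proof.
move=> mt; have P0 h : (0 <= Psi h)%E by exact: contractible_ge0 cPsi _.
split.
- by move=> h; apply: integral_ge0 => x _; exact: symm_ge0.
- move=> d' U H mH.
  have := measurable_fun_fubini_tonelli_F (m2 := mu) _ (measurable_symm_pair mH mt).
  by apply => p; exact: symm_ge0.
- move=> h G bG.
  have mhG s : measurable_fun setT (fun x => h s + G s x).
    by apply: measurable_funD => //; exact: (bG s).1.
  have J r : (Psi (fun s => h s + \int[mu]_x G s x + r s)%R
      <= \int[mu]_y Psi (fun s => h s + G s y + r s)%R)%E.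
    have := contractible_jensen cPsi (fun s => h s + r s) bG.
    rewrite (_ : (fun s => _) = (fun s => h s + \int[mu]_x G s x + r s)); last first.
      by apply/funext => s; rewrite addrAC.
    rewrite (_ : (fun y => Psi _) = (fun y => Psi (fun s => h s + G s y + r s)))//.
    by apply/funext => y; congr Psi; apply/funext => s; rewrite addrAC.
  have mhGt : measurable_fun setT
     (fun p : T * T => symm Psi t (fun s => h s + G s p.1) p.2).
    exact: (measurable_symm_pair (H := fun s x => h s + G s x)).
  rewrite (fubini_tonelli (m1 := mu) (m2 := mu)
    (fun p => symm Psi t (fun s => h s + G s p.1)%R p.2))//=; last first.
    by move=> p; exact: symm_ge0.
  apply: ge0_le_integral => //.
  + by move=> x _; exact: symm_ge0.
  + exact: measurable_symm1.
  + have := measurable_fun_fubini_tonelli_G (m1 := mu) _ mhGt.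
    by apply => p; exact: symm_ge0.
  move=> x _; rewrite /symm ge0_integralZl_EFin//; last 2 first.
  + by move=> y _; rewrite adde_ge0.
  + apply: emeasurable_funD.
      apply: (contractible_measurable cPsi (H := fun s y => h s + G s y + t s x)) => s.
      exact: measurable_funD.
    apply: (contractible_measurable cPsi (H := fun s y => h s + G s y - t s x)) => s.
    exact: measurable_funB.
  apply: lee_wpmul2l => //; rewrite ge0_integralD//; last 2 first.
  + apply: (contractible_measurable cPsi (H := fun s y => h s + G s y + t s x)) => s.
    exact: measurable_funD.
  + apply: (contractible_measurable cPsi (H := fun s y => h s + G s y - t s x)) => s.
    exact: measurable_funB.
  apply: leeD.
  + exact: (J (fun s => t s x)).
  + exact: (J (fun s => - t s x)).
- move=> h1 h2.
  have m12 : measurable_fun setT (fun x => symm Psi t h1 x + symm Psi t h2 x)%E.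
    by apply: emeasurable_funD; exact: measurable_symm1.
  rewrite -ge0_integralD//; [|by move=> x _; exact: symm_ge0|exact: measurable_symm1
    |by move=> x _; exact: symm_ge0|exact: measurable_symm1].
  rewrite -ge0_integralZl_EFin//; last first.
    by move=> x _; rewrite adde_ge0// symm_ge0.
  apply: ge0_le_integral => //.
  + by move=> x _; exact: symm_ge0.
  + exact: measurable_symm1.
  + exact: emeasurable_funM.
  move=> x _; rewrite /symm -ge0_muleDr ?adde_ge0//.
  apply: lee_wpmul2l => //; rewrite addeACA ge0_muleDr ?adde_ge0//.
  apply: leeD.
  + rewrite (_ : (fun s => _) = (fun s => ((h1 s + t s x) + (h2 s + t s x)) / 2)); last first.
      by apply/funext => s; field.
    exact: (contractible_midpoint cPsi).
  + rewrite (_ : (fun s => _) = (fun s => ((h1 s - t s x) + (h2 s - t s x)) / 2)); last first.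
      by apply/funext => s; field.
    exact: (contractible_midpoint cPsi).
- move=> h p q pq pq2.
  have D r : (\int[mu]_x symm Psi t (fun s => h s + r s)%R x
     + \int[mu]_x symm Psi t (fun s => h s - r s)%R x
     = \int[mu]_x (symm Psi t (fun s => h s + r s)%R x
     + symm Psi t (fun s => h s - r s)%R x))%E.
    rewrite ge0_integralD//; [by move=> x _; exact: symm_ge0|exact: measurable_symm1
      |by move=> x _; exact: symm_ge0|exact: measurable_symm1].
  rewrite !D; apply: ge0_le_integral => //.
  + by move=> x _; rewrite adde_ge0// symm_ge0.
  + by apply: emeasurable_funD; exact: measurable_symm1.
  + by apply: emeasurable_funD; exact: measurable_symm1.
  move=> x _; rewrite /symm -!ge0_muleDr ?adde_ge0//.
  apply: lee_wpmul2l => //; rewrite addeACA [leRHS]addeACA.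
  have E r (e : R) : (Psi (fun s => h s + r s + e * t s x)%R
      + Psi (fun s => h s - r s + e * t s x)%R
    = Psi (fun s => (h s + e * t s x) + r s)%R + Psi (fun s => (h s + e * t s x) - r s)%R)%E.
    by congr (Psi _ + Psi _)%E; apply/funext => s; ring.
  have e1 r : (fun s => h s + r s + t s x) = (fun s => h s + r s + 1 * t s x).
    by apply/funext => s; rewrite mul1r.
  have e2 r : (fun s => h s + r s - t s x) = (fun s => h s + r s + (-1) * t s x).
    by apply/funext => s; rewrite mulN1r.
  rewrite !(e1 (fun s => - _ s)) !e1 !(e2 (fun s => - _ s)) !e2 !E.
  by apply: leeD; exact: (contractible_contract cPsi).
Qed.

(* Symmetrization uses Jensen's inequality against an independent copy;
   averaging the two signs then makes the copy disappear. *)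
Lemma symmetrization_contraction g t h :
  (forall s, bmeas (g s)) -> (forall s, measurable_fun setT (t s)) ->
  (forall s x, `|2 * g s x| <= `|t s x|) ->
  (forall s s' x, `|2 * g s x - 2 * g s' x| <= `|t s x - t s' x|) ->
  (\int[mu]_z Psi (fun s => h s + (\int[mu]_x g s x - g s z))%R
     <= \int[mu]_x symm Psi t h x)%E.
Proof.
move=> bg mt gt gt2; have P0 h' : (0 <= Psi h')%E by exact: contractible_ge0 cPsi _.
have mg s : measurable_fun setT (g s) by exact: (bg s).1.
have mD (c : R) : measurable_fun setT (fun z => Psi (fun s => h s + c * g s z)%R).
  apply: (contractible_measurable cPsi (H := fun s z => h s + c * g s z)) => s.
  by apply: measurable_funD => //; exact: measurable_funM.
(* [h + g x - g z] is the midpoint of [h + 2 g x] and [h - 2 g z]: the copy [x] and the observation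
   [z] separate, and the factor 2 in the hypotheses on [t] originates here. *)
pose A z := Psi (fun s => h s + 2 * g s z)%R.
pose B z := Psi (fun s => h s + (- 2) * g s z)%R.
have mA : measurable_fun setT A by exact: mD.
have mB : measurable_fun setT B by exact: mD.
have step z : (Psi (fun s => h s + (\int[mu]_x g s x - g s z))%R
    <= 2^-1%:E * (\int[mu]_x A x + B z))%E.
  rewrite (_ : (fun s => _) = (fun s => (h s - g s z) + \int[mu]_x g s x)); last first.
    by apply/funext => s; ring.
  apply: le_trans (contractible_jensen cPsi _ bg) _.
  have -> : (\int[mu]_x A x + B z = \int[mu]_x (A x + B z))%E.
    rewrite ge0_integralD//.
    - by rewrite integral_prob_cst.
    - by move=> x _; exact: P0.
    - by move=> x _; exact: P0.
  rewrite -ge0_integralZl_EFin//; last 2 first.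
  - by move=> x _; rewrite adde_ge0//; exact: P0.
  - exact: emeasurable_funD.
  apply: ge0_le_integral => //.
  - apply: (contractible_measurable cPsi (H := fun s x => h s - g s z + g s x)) => s.
    exact: measurable_funD.
  - by apply: emeasurable_funM => //; exact: emeasurable_funD.
  move=> x _; rewrite (_ : (fun s => _) =
    (fun s => ((h s + 2 * g s x) + (h s + (- 2) * g s z)) / 2)); last first.
    by apply/funext => s; field.
  exact: (contractible_midpoint cPsi).
apply: (@le_trans _ _ (\int[mu]_z (2^-1%:E * (\int[mu]_x A x + B z)))%E).
  apply: ge0_le_integral => //.
  - apply: (contractible_measurable cPsi
      (H := fun s z => h s + (\int[mu]_x g s x - g s z))) => s.
    by apply: measurable_funD => //; exact: measurable_funB.
  - by apply: emeasurable_funM => //; exact: emeasurable_funD.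
have iA0 : (0 <= \int[mu]_x A x)%E by apply: integral_ge0 => x _; exact: P0.
have B0 z : (0 <= B z)%E by exact: P0.
(* The copy and the observation have the same law, so after integration [A x] may be read as [A z]:
   only the two signs of one observation are left. *)
have -> : (\int[mu]_z (2^-1%:E * (\int[mu]_x A x + B z))
    = \int[mu]_z (2^-1%:E * (A z + B z)))%E.
  rewrite !ge0_integralZl_EFin//; last 4 first.
  - by move=> x _; rewrite adde_ge0//; exact: P0.
  - exact: emeasurable_funD.
  - by move=> x _; rewrite adde_ge0.
  - exact: emeasurable_funD.
  have A0 x : (0 <= A x)%E by exact: P0.
  congr (_ * _)%E; rewrite [RHS]ge0_integralD//.
  move: (\int[mu]_x A x)%E iA0 => iA iA0.
  by rewrite ge0_integralD// integral_prob_cst.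
apply: ge0_le_integral => //.
- by move=> x _; rewrite mule_ge0// adde_ge0//; exact: P0.
- by apply: emeasurable_funM => //; exact: emeasurable_funD.
- exact: measurable_symm1.
move=> x _; apply: lee_wpmul2l => //.
rewrite /A /B (_ : (fun s => h s + - 2 * g s x) = (fun s => h s - 2 * g s x)); last first.
  by apply/funext => s; rewrite mulNr.
apply: (contractible_contract cPsi h (p := fun s => 2 * g s x)
  (t := fun s => t s x)) => [s|s s'].
  exact: gt.
exact: gt2.
Qed.

End props.

Lemma contractible_radexp t k : (forall s, measurable_fun setT (t s)) ->
  contractible mu (radexp mu t k).
Proof.
move=> mt; elim: k => [|k IH] /=; first exact: contractible_expmax.
exact: contractible_symm.
Qed.

End rademacher_step.

(** * Independent observations *)

Section independence.
Context {R : realType} {dO d : measure_display}.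
Context {Omega : measurableType dO} {T : measurableType d}.
Variables (P : probability Omega R) (law : probability T R).

(** The joint law agrees with the product on rectangles, hence everywhere, and Tonelli applies. [U]
    is arbitrary so that [V] can be the identity of [Omega] into a coarser sigma-algebra. *)
Lemma independent_integral d' (U : measurableType d') (V : Omega -> U)
    (W : Omega -> T) (F : U * T -> \bar R) :
  measurable_fun setT V -> measurable_fun setT W ->
  (forall A B, measurable A -> measurable B ->
     P (V @^-1` A `&` W @^-1` B) = P (V @^-1` A) * law B)%E ->
  measurable_fun setT F -> (forall p, 0 <= F p)%E ->
  (\int[P]_w F (V w, W w) = \int[P]_w \int[law]_z F (V w, z))%E.
Proof.
move=> mV mW ind mF F0.
pose V' : {mfun Omega >-> U} := mfun_Sub (mem_set mV).
pose PV := distribution P V'.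
pose VW w := (V w, W w).
have mVW : measurable_fun setT VW by exact/measurable_fun_pairP.
pose VW' : {mfun Omega >-> (U * T)%type} := mfun_Sub (mem_set mVW).
pose m' := distribution P VW'.
have mE X : measurable X -> (PV \x law)%E X = m' X.
  apply: product_measure_unique => A B mA mB.
  by rewrite /m' /PV /distribution /= /pushforward /= -ind.
transitivity (\int[m']_p F p)%E.
  by rewrite ge0_integral_distribution.
transitivity (\int[PV \x law]_p F p)%E.
  by apply: eq_measure_integral => A mA _; exact/esym/mE.
rewrite fubini_tonelli1//.
rewrite ge0_integral_distribution//; last first.
  by move=> u; apply: integral_ge0 => z _; exact: F0.
exact: measurable_fun_fubini_tonelli_F.
Qed.

Section past.
Variables (n : nat) (Z : 'I_n -> Omega -> T).
Hypothesis iidZ : iid_sample P law Z.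

(* A pi-system generating the sigma-algebra of Z_0, .., Z_(k-1). *)
Definition past (k : nat) : set (set Omega) :=
  [set B | exists A : 'I_n -> set T, [/\ forall i, measurable (A i),
     forall i : 'I_n, ~~ (i < k)%N -> A i = setT &
     B = \bigcap_(i in [set: 'I_n]) (Z i @^-1` A i)]].

Let mZ i : measurable_fun setT (Z i). Proof. by have [] := iidZ. Qed.

Let mZpre i A : measurable A -> measurable (Z i @^-1` A).
Proof. by move=> mA; rewrite -[X in measurable X]setTI; exact: mZ. Qed.

Lemma past_measurable k : past k `<=` measurable.
Proof.
move=> _ [A [mA _ ->]]; apply: fin_bigcap_measurable => // i _; exact: mZpre.
Qed.

Lemma past_setI k : setI_closed (past k).
Proof.
move=> _ _ [A [mA AT ->]] [B [mB BT ->]].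
exists (fun i => A i `&` B i); split.
- by move=> i; exact: measurableI.
- by move=> i ik; rewrite AT// BT// setIT.
- by rewrite -bigcapI.
Qed.

Lemma past_setT k : past k setT.
Proof.
exists (fun=> setT); split => //.
by rewrite predeqE => w; split.
Qed.

Lemma measurable_past k (i : 'I_n) : (i < k)%N ->
  measurable_fun (setT : set (g_sigma_algebraType (past k))) (Z i).
Proof.
move=> ik _ A mA; rewrite setTI; apply: sub_sigma_algebra.
exists (fun j => if j == i then A else setT); split.
- by move=> j; case: ifPn.
- by move=> j; case: eqP => // ->; rewrite ik.
- rewrite predeqE => w; split => [ZA j _|/(_ i I)] /=; last by rewrite eqxx.
  by case: eqP => [->|].
Qed.

(** For fixed [B] both sides are finite measures in [A], equal on a pi-system that generates the
    past. *)
Lemma past_independent (k : 'I_n) A B : <<s past k >> A -> measurable B ->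
  (P (A `&` Z k @^-1` B) = P A * law B)%E.
Proof.
move=> sA mB.
have [Zm [Zlaw ind]] := iidZ.
pose c : {nonneg R} := NngNum (fine_ge0 (measure_ge0 law B)).
have cE : c%:num%:E = law B by rewrite /= fineK// fin_num_measure.
have mZB : measurable (Z k @^-1` B) by exact: mZpre.
have msE X : mscale c P X = (law B * P X)%E by rewrite -cE.
have : mrestr P mZB A = mscale c P A.
  apply: (g_sigma_algebra_measure_unique (past k) (@past_measurable k)
    (fun=> setT)) sA => //.
  - by move=> _; exact: past_setT.
  - by rewrite bigcup_const.
  - exact: past_setI.
  - move=> _ [A' [mA' AT ->]].
    rewrite /= msE /mrestr.
    (* Membership in [past k] imposes nothing on [Z k], as [k < k] fails, so [B] can be inserted at
       this coordinate. *)
    pose A2 i := if i == k then B else A' i.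
    have mA2 i : measurable (A2 i) by rewrite /A2; case: ifP.
    have -> : \bigcap_(i in [set: 'I_n]) Z i @^-1` A' i `&` Z k @^-1` B
        = \bigcap_(i in [set: 'I_n]) Z i @^-1` A2 i.
      rewrite predeqE => w; split => [[wA wB] i _|wA].
        by rewrite /A2 /=; case: eqP => [->|_]; [exact: wB|exact: wA].
      split; last by have := wA k I; rewrite /A2 /= eqxx.
      move=> i _; have := wA i I; rewrite /A2 /=; case: eqP => // -> _.
      by rewrite AT// ltnn.
    rewrite !ind// (bigD1 k)//= [in RHS](bigD1 k)//= {1}/A2 eqxx.
    rewrite Zlaw// AT ?ltnn// preimage_setT probability_setT mul1e.
    congr (_ * _)%E; apply: eq_bigr => i ik.
    by rewrite /A2 (negbTE ik).
  - by move=> _; rewrite -ge0_fin_numE// fin_num_measure.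
by rewrite msE /mrestr muleC.
Qed.

Lemma past_integral (k : 'I_n) (F : g_sigma_algebraType (past k) * T -> \bar R) :
  measurable_fun setT F -> (forall p, 0 <= F p)%E ->
  (\int[P]_w F (w, Z k w) = \int[P]_w \int[law]_z F (w, z))%E.
Proof.
move=> mF F0; apply: (@independent_integral _ (g_sigma_algebraType (past k))
  (fun w => w) (Z k) F) => //.
- move=> _ A mA; rewrite setTI preimage_id.
  have := smallest_sub (@sigma_algebra_measurable _ Omega) (@past_measurable k).
  exact.
- by move=> A B mA mB; rewrite preimage_id; exact: past_independent.
Qed.

End past.
End independence.

(** * Integrating out the observations one at a time *)

Section iid_sums.
Context {R : realType} {dO d : measure_display}.
Context {Omega : measurableType dO} {T : measurableType d}.
Variables (P : probability Omega R) (law : probability T R).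
Variables (n : nat) (Z : 'I_n -> Omega -> T).
Hypothesis iidZ : iid_sample P law Z.
Variable S : finType.

(** The last remaining observation is integrated with the earlier ones held fixed; their partial sum
    plays the role of [h], which is why the step hypothesis is required for all [h']. [Psi] need not
    be linear, so the lemma serves both symmetrization and plain exponential sums. *)
Lemma iid_peel (Psi : nat -> (S -> R) -> \bar R) (G : S -> T -> R) (h : S -> R) :
  (forall s, measurable_fun setT (G s)) ->
  (forall k h', 0 <= Psi k h')%E ->
  (forall k d' (U : measurableType d') (H : S -> U -> R),
    (forall s, measurable_fun setT (H s)) ->
    measurable_fun setT (fun u => Psi k (fun s => H s u))) ->
  (forall k h', \int[law]_z Psi k (fun s => h' s + G s z)%R <= Psi k.+1 h')%E ->
  (\int[P]_w Psi 0%N (fun s => h s + \sum_(i < n) G s (Z i w))%R <= Psi n h)%E.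
Proof.
move=> mG Psi0 mPsi step.
have mZ i : measurable_fun setT (Z i) by have [] := iidZ.
pose H k s w := h s + \sum_(i < n | (i < k)%N) G s (Z i w).
have mH k s : measurable_fun setT (H k s).
  apply: measurable_funD => //.
  under eq_fun do rewrite big_mkcond.
  apply: measurable_sum => i; case: (i < k)%N => //.
  exact: measurableT_comp (mG s) (mZ i).
suff E k : (k <= n)%N ->
    (\int[P]_w Psi 0%N (fun s => H n s w) <= \int[P]_w Psi k (fun s => H (n - k)%N s w))%E.
  have := E n (leqnn n); rewrite subnn.
  have -> : (fun w => Psi n (fun s => H 0%N s w)) = (fun=> Psi n h).
    by apply/funext => w; congr Psi; apply/funext => s; rewrite /H big_pred0// addr0.
  rewrite integral_prob_cst; apply: le_trans.
  rewrite le_eqVlt; apply/orP; left; apply/eqP; apply: eq_integral => w _.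
  congr Psi; apply/funext => s; rewrite /H; congr (_ + _); apply: eq_bigl => i.
  by rewrite ltn_ord.
elim: k => [_|k IH kn]; first by rewrite subn0.
apply: le_trans (IH (ltnW kn)) _.
have nk : (n - k.+1 < n)%N by rewrite ltn_subrL /= (leq_ltn_trans (leq0n k) kn).
pose K := Ordinal nk.
have -> : (n - k = (n - k.+1).+1)%N by rewrite subnSK.
set m := (n - k.+1)%N in nk K *.
have HS s w : H m.+1 s w = H m s w + G s (Z K w).
  rewrite /H -addrA; congr (_ + _); rewrite (bigD1 K)//= addrC; congr (_ + _).
  apply: eq_bigl => i; rewrite ltnS -(inj_eq val_inj) /= ltn_neqAle andbC.
  by [].
(* [F] is measurable for the sigma-algebra of the first [m] observations, which is what lets [Z K]
   be integrated separately. *)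
pose F (p : g_sigma_algebraType (past Z m) * T) :=
  Psi k (fun s => H m s p.1 + G s p.2)%R.
have mHp s : measurable_fun (setT : set (g_sigma_algebraType (past Z m))) (H m s).
  apply: measurable_funD => //.
  under eq_fun do rewrite big_mkcond.
  apply: measurable_sum => i; case im: (i < m)%N => //.
  exact: (measurableT_comp (mG s) (measurable_past (Z := Z) (k := m) im)).
have mF : measurable_fun setT F.
  apply: (mPsi k _ (g_sigma_algebraType (past Z m) * T)%type
    (fun s p => H m s p.1 + G s p.2)) => s.
  apply: measurable_funD.
    exact: measurableT_comp (mHp s) measurable_fst.
  exact: measurableT_comp (mG s) measurable_snd.
have -> : (\int[P]_w Psi k (fun s => H m.+1 s w) = \int[P]_w F (w, Z K w))%E.
  apply: eq_integral => w _; rewrite /F /=; congr Psi.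
  by apply/funext => s; rewrite HS.
rewrite (past_integral iidZ (k := K) (F := F) mF); last by move=> p; exact: Psi0.
apply: ge0_le_integral => //.
- by move=> w _; apply: integral_ge0 => z _; exact: Psi0.
- have mF' : measurable_fun setT (fun p : Omega * T => Psi k (fun s => H m s p.1 + G s p.2)%R).
    apply: (mPsi k _ (Omega * T)%type (fun s p => H m s p.1 + G s p.2)) => s.
    apply: measurable_funD.
      exact: measurableT_comp (mH m s) measurable_fst.
    exact: measurableT_comp (mG s) measurable_snd.
  have := measurable_fun_fubini_tonelli_F (m2 := law) _ mF'.
  by apply => p; exact: Psi0.
- exact: mPsi.
- by move=> w _; exact: (step k (fun s => H m s w)).
Qed.

Lemma iid_radexp (g t : S -> T -> R) (h : S -> R) :
  (forall s, bmeas (g s)) -> (forall s, measurable_fun setT (t s)) ->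
  (forall s x, `|2 * g s x| <= `|t s x|) ->
  (forall s s' x, `|2 * g s x - 2 * g s' x| <= `|t s x - t s' x|) ->
  (\int[P]_w (expmax (fun s => h s + \sum_(i < n) (\int[law]_x g s x - g s (Z i w)))%R)%:E
    <= radexp law t n h)%E.
Proof.
move=> bg mt gt gt2.
apply: (@iid_peel (radexp law t) (fun s z => \int[law]_x g s x - g s z)).
- by move=> s; apply: measurable_funB => //; exact: (bg s).1.
- by move=> k h'; exact: contractible_ge0 (contractible_radexp _ k mt) _.
- by move=> k d' U H mH; exact: (contractible_measurable (contractible_radexp law k mt) mH).
- move=> k h'; exact: (symmetrization_contraction (contractible_radexp law k mt)).
Qed.

(** Here each peeling step is an equality: [Psi k] carries the [k]-th power of the one-observation
    moment, separately for each index. *)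
Lemma iid_sum_expR (g : S -> T -> R) (h : S -> R) :
  (forall s, bmeas (g s)) ->
  (\int[P]_w (\sum_s expR (h s + \sum_(i < n) g s (Z i w)))%:E
    <= (\sum_s expR (h s) * (\int[law]_x expR (g s x)) ^+ n)%:E)%E.
Proof.
move=> bg.
pose Psi k (h : S -> R) := (\sum_s expR (h s) * (\int[law]_x expR (g s x)) ^+ k)%:E.
have := @iid_peel Psi g h.
have -> : (fun w => Psi 0%N (fun s => h s + \sum_(i < n) g s (Z i w)))
    = (fun w => (\sum_s expR (h s + \sum_(i < n) g s (Z i w)))%:E).
  apply/funext => w; rewrite /Psi; congr EFin; apply: eq_bigr => s _.
  by rewrite expr0 mulr1.
have q0 s : 0 <= \int[law]_x expR (g s x) by apply: Rintegral_ge0 => x _; exact: expR_ge0.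
apply.
- by move=> s; exact: (bg s).1.
- move=> k h'; rewrite lee_fin; apply: sumr_ge0 => s _.
  by rewrite mulr_ge0 ?expR_ge0// exprn_ge0.
- move=> k d' U H mH; apply/measurable_EFinP; apply: measurable_sum => s.
  by apply: measurable_funM => //; apply: measurableT_comp => //; exact: measurable_expR.
- move=> k h'.
  have bh s : bmeas (fun z => expR (h' s + g s z)).
    by apply: bmeas_expR; exact: (bmeasD (bmeas_cst _) (bg s)).
  have bh' s : bmeas (fun z => (\int[law]_x expR (g s x)) ^+ k * expR (h' s + g s z)).
    exact: bmeasZ.
  rewrite /Psi.
  under eq_integral => z _ do under eq_bigr do rewrite mulrC.
  rewrite bmeas_RintegralE; last exact: bmeas_sum.
  rewrite bmeas_Rintegral_sum// lee_fin le_eqVlt; apply/orP; left; apply/eqP.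
  apply: eq_bigr => s _; rewrite bmeas_RintegralZ//.
  have -> : \int[law]_x expR (h' s + g s x) = expR (h' s) * \int[law]_x expR (g s x).
    rewrite -bmeas_RintegralZ; last exact: bmeas_expR.
    by apply: eq_Rintegral => x _; rewrite expRD.
  by rewrite exprSr; ring.
Qed.

End iid_sums.

(** * Processes that are linear on the simplex *)

Section linear_radexp.
Context d (T : measurableType d) {R : realType} (mu : probability T R).
Variables (S J : finType) (th : S -> J -> R).
Hypotheses (th0 : forall s j, 0 <= th s j) (th1 : forall s, \sum_j th s j = 1).

(** After convexity, the weights are dropped because they are at most 1. Normalization is restored
    later by the prior, which sits inside [v]. *)
Lemma expR_sum_le (w v : J -> R) : (forall j, 0 <= w j) -> \sum_j w j = 1 ->
  expR (\sum_j w j * v j) <= \sum_j expR (v j).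
Proof.
move=> w0 w1; set m := \sum_j _.
have w1j j : w j <= 1.
  by rewrite -w1 (bigD1 j)//= lerDl sumr_ge0.
apply: (@le_trans _ _ (\sum_j w j * expR (v j))); last first.
  by apply: ler_sum => j _; rewrite ler_piMl ?expR_ge0.
have -> : expR m = \sum_j w j * (expR m * (1 + (v j - m))).
  have -> : \sum_j w j * (expR m * (1 + (v j - m)))
      = expR m * ((1 - m) * \sum_j w j + \sum_j w j * v j).
    by rewrite mulr_sumr -big_split/= mulr_sumr; apply: eq_bigr => j _; ring.
  by rewrite w1 -/m; ring.
apply: ler_sum => j _; rewrite ler_wpM2l//.
rewrite -[leRHS](_ : expR m * expR (v j - m) = _); last by rewrite -expRD; congr expR; ring.
by rewrite ler_wpM2l ?expR_ge0// expR_ge1Dx.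
Qed.

(** Domination of [h] by a linear function with vertex values [v] is stable under the shifts: they
    turn [v j] into [v j + a j x] or [v j - a j x]. The maximum over [S] is thus traded for a sum
    over vertices only once, at the bottom of the induction, and the size of [S] does not appear. *)
Lemma radexp_linear_le (a : J -> T -> R) k (h : S -> R) (v : J -> R) :
  (forall j, bmeas (a j)) ->
  (forall s, h s <= \sum_j th s j * v j) ->
  (radexp mu (fun s x => \sum_j th s j * a j x)%R k h
   <= (\sum_j expR (v j)
        * (\int[mu]_x ((expR (a j x) + expR (- a j x)) / 2)) ^+ k)%:E)%E.
Proof.
move=> ba; pose q j := \int[mu]_x ((expR (a j x) + expR (- a j x)) / 2).
under [X in (_ <= X%:E)%E]eq_bigr => j _ do rewrite -/(q j).
have bc j : bmeas (fun x => (expR (a j x) + expR (- a j x)) / 2).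
  under eq_fun do rewrite mulrC.
  by apply/bmeasZ/bmeasD; [exact: bmeas_expR|exact/bmeas_expR/bmeasN].
have q0 j : 0 <= q j.
  apply: Rintegral_ge0 => x _; by rewrite divr_ge0 ?addr_ge0 ?expR_ge0.
elim: k h v => [|k IH] h v hv.
  rewrite /= lee_fin; apply: expmax_le => [|s].
    by apply: sumr_ge0 => j _; rewrite expr0 mulr1 expR_ge0.
  under eq_bigr do rewrite expr0 mulr1.
  by apply: le_trans (expR_sum_le v (th0 s) (th1 s)); rewrite ler_expR.
have bI : bmeas (fun x => \sum_j (expR (v j) * q j ^+ k)
    * ((expR (a j x) + expR (- a j x)) / 2)).
  by apply: bmeas_sum => j; exact: bmeasZ.
have -> : \sum_j expR (v j) * q j ^+ k.+1 = \int[mu]_x \sum_j (expR (v j) * q j ^+ k)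
    * ((expR (a j x) + expR (- a j x)) / 2).
  rewrite bmeas_Rintegral_sum; last by move=> j; exact: bmeasZ.
  by apply: eq_bigr => j _; rewrite bmeas_RintegralZ// exprSr mulrA.
rewrite -bmeas_RintegralE//=.
have mt s : measurable_fun setT (fun x => \sum_j th s j * a j x).
  by have [] : bmeas (fun x => \sum_j th s j * a j x) by apply: bmeas_sum => j; exact: bmeasZ.
have cr := contractible_radexp mu k mt.
apply: ge0_le_integral => //.
- by move=> x _; exact: (symm_ge0 cr (fun s x => \sum_j th s j * a j x) h x).
- exact: (measurable_symm1 cr h mt).
- by apply/measurable_EFinP; exact: bI.1.
move=> x _.
have -> : \sum_j expR (v j) * q j ^+ k * ((expR (a j x) + expR (- a j x)) / 2)
    = 2^-1 * ((\sum_j expR (v j + a j x) * q j ^+ k)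
              + (\sum_j expR (v j - a j x) * q j ^+ k)).
  rewrite -big_split/= mulr_sumr; apply: eq_bigr => j _.
  by rewrite !expRD; field.
rewrite EFinM EFinD; apply: lee_wpmul2l; first by rewrite lee_fin invr_ge0.
apply: leeD; apply: IH => s.
- rewrite (le_trans (lerD (hv s) (lexx _)))// -big_split/=.
  by rewrite le_eqVlt; apply/orP; left; apply/eqP; apply: eq_bigr => j _; rewrite mulrDr.
- rewrite (le_trans (lerD (hv s) (lexx _)))// -sumrB.
  by rewrite le_eqVlt; apply/orP; left; apply/eqP; apply: eq_bigr => j _; rewrite mulrBr.
Qed.

End linear_radexp.

(** * The simplex *)

Section simplex.
Context {R : realType} (M : nat).
Implicit Types th : 'I_M -> R.

Lemma simplex_le1 th j : simplex th -> 0 <= th j <= 1.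
Proof.
move=> [th0 th1]; rewrite th0 /= -th1 (bigD1 j)//= lerDl.
by apply: sumr_ge0.
Qed.

Lemma simplex_convex th th' (a : R) : 0 <= a <= 1 -> simplex th -> simplex th' ->
  simplex (fun j => a * th j + (1 - a) * th' j).
Proof.
move=> /andP[a0 a1] [p0 p1] [q0 q1]; split.
  by move=> j; rewrite addr_ge0// mulr_ge0// subr_ge0.
by rewrite big_split/= -!mulr_sumr p1 q1; ring.
Qed.

Lemma simplex_vertex (j : 'I_M) : simplex (fun k => (k == j)%:R : R).
Proof.
split=> [k|]; first by rewrite ler0n.
by rewrite (bigD1 j)//= eqxx big1 ?addr0// => k /negbTE ->.
Qed.

Lemma sum_vertex (j : 'I_M) (u : 'I_M -> R) : \sum_k (k == j)%:R * u k = u j.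
Proof.
rewrite (bigD1 j)//= eqxx mul1r big1 ?addr0// => k /negbTE ->.
by rewrite mul0r.
Qed.

Lemma simplex_sum_cst th (c : R) : simplex th -> \sum_j th j * c = c.
Proof. by move=> [_ th1]; rewrite -mulr_suml th1 mul1r. Qed.

Lemma simplex_norm_sum_le th (u : 'I_M -> R) (c : R) : simplex th ->
  (forall j, `|u j| <= c) -> `|\sum_j th j * u j| <= c.
Proof.
move=> sth uc; apply: le_trans (ler_norm_sum _ _ _) _.
rewrite -[leRHS](simplex_sum_cst c sth); apply: ler_sum => j _.
by rewrite normrM (ger0_norm (sth.1 j)) ler_wpM2l// sth.1.
Qed.

(** Rounding the coordinates would leave the simplex. Each grid cell of side [1 / N] that meets the
    simplex receives a representative inside it, and the other cells receive the default [th0]. *)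
Lemma simplex_net (e : R) (th0 : 'I_M -> R) : 0 < e -> simplex th0 ->
  exists (S : finType) (net : S -> 'I_M -> R), (forall s, simplex (net s)) /\
    forall th, simplex th -> exists s, forall j, `|th j - net s j| <= e.
Proof.
move=> e0 sth0; pose N := (Num.truncn e^-1).+1.
have N0 : 0 < N%:R :> R by rewrite ltr0n.
have Ne : N%:R^-1 <= e.
  rewrite invf_ple ?posrE//; apply/ltW; exact: truncnS_gt.
pose cell th : {ffun 'I_M -> 'I_N.+1} :=
  [ffun j => inord (Num.truncn (N%:R * th j))].
pose net s := xget th0 [set th | simplex th /\ cell th = s].
exists {ffun 'I_M -> 'I_N.+1}, net; split => [s|th sth].
  by rewrite /net; case: xgetP => [th _ []|].
exists (cell th) => j; set s := cell th.
have [snet cnet] : simplex (net s) /\ cell (net s) = s.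
  by rewrite /net; case: xgetP => [th' _ []|/(_ th)[]].
have bnd (t : 'I_M -> R) : simplex t -> (Num.truncn (N%:R * t j) <= N)%N /\
    (Num.truncn (N%:R * t j))%:R <= N%:R * t j < (Num.truncn (N%:R * t j))%:R + 1.
  move=> st; have /andP[t0 t1] := simplex_le1 j st.
  have Nt0 : 0 <= N%:R * t j by rewrite mulr_ge0.
  split; last by rewrite natr1; exact: truncn_itv.
  rewrite -(ler_nat R); apply: (@le_trans _ _ (N%:R * t j)).
    by rewrite truncn_le.
  by rewrite ler_piMr.
have := congr1 (fun f : {ffun 'I_M -> 'I_N.+1} => val (f j)) cnet.
rewrite /s !ffunE.
have [n1 /andP[h1 h2]] := bnd _ snet; have [n2 /andP[h3 h4]] := bnd _ sth.
rewrite /= !inordK// => E; rewrite E in h1 h2.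
apply: le_trans Ne.
have : `|N%:R * (th j - net s j)| <= 1.
  by rewrite mulrBr ler_norml; apply/andP; split; lra.
rewrite normrM (ger0_norm (ltW N0)) => h.
by rewrite -(ler_pM2l N0) mulfV// lt0r_neq0.
Qed.

(** The sets of almost minimizers generate a proper filter containing the compact cube. A cluster
    point lies in the simplex, which is closed, and attains the infimum by the Lipschitz bound;
    regularity of [H] is required on the simplex only. *)
Lemma simplex_argmin (H : ('I_M -> R) -> R) (L : R) (th0 : 'I_M -> R) :
  simplex th0 ->
  (forall th th', simplex th -> simplex th' ->
     `|H th - H th'| <= L * \sum_j `|th j - th' j|) ->
  exists th, simplex th /\ forall th', simplex th' -> H th <= H th'.
Proof.
move=> sth0 lipH.
wlog L0 : L lipH / 0 <= L.
  move=> W; apply: (W `|L|) => // th th' sth sth'.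
  by rewrite (le_trans (lipH _ _ sth sth'))// ler_wpM2r ?sumr_ge0// ler_norm.
pose V := [set H th | th in [set th | simplex th]].
have V0 : V !=set0 by exists (H th0), th0.
have l1M th th' : simplex th -> simplex th' -> \sum_j `|th j - th' j| <= M%:R.
  move=> sth sth'; apply: (@le_trans _ _ (\sum_(j < M) (1 : R))); last first.
    by rewrite sumr_const card_ord.
  apply: ler_sum => j _.
  have /andP[? ?] := simplex_le1 j sth; have /andP[? ?] := simplex_le1 j sth'.
  by rewrite ler_norml; apply/andP; split; lra.
have Vb : has_lbound V.
  exists (H th0 - L * M%:R) => _ [th sth <-].
  have := lipH _ _ sth sth0; rewrite ler_norml => /andP[h _].
  have := ler_wpM2l L0 (l1M _ _ sth sth0); lra.
pose A (e : R) := [set th | simplex th /\ H th < inf V + e].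
have A0 e : 0 < e -> A e !=set0.
  move=> e0; have [_ [th sth <-] h] := @inf_adherent _ V e e0 (conj V0 Vb).
  by exists th.
pose F := filter_from [set e : R | 0 < e] A.
have FF : ProperFilter F.
  apply: filter_from_proper => //.
  apply: filter_from_filter; first by exists 1; exact: ltr01.
  move=> i j /= i0 j0; exists (Num.min i j); first by rewrite /= lt_min i0.
  by move=> th [sth]; rewrite -ltrBlDl lt_min => /andP[h1 h2]; split; split => //;
    rewrite -ltrBlDl.
have cbox : compact [set f : prod_topology (fun _ : 'I_M => R) |
    forall i, `[0, 1]%classic (f i)].
  apply: (@tychonoff 'I_M (fun _ => R : topologicalType) (fun=> `[0, 1]%classic)).
  by move=> _; exact: segment_compact.
have Fbox : F [set f | forall i, `[0, 1]%classic (f i)].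
  exists 1; first exact: ltr01.
  move=> th [sth _] i; rewrite /= in_itv/=; exact: simplex_le1.
have [th [_ clth]] := cbox _ FF Fbox.
have near_th (dl : R) : 0 < dl -> exists2 th', simplex th' /\ H th' < inf V + dl &
    forall j, `|th j - th' j| < dl.
  move=> d0.
  have nb : nbhs th [set f : prod_topology (fun _ : 'I_M => R) |
      forall j, `|th j - f j| < dl].
    have Fth : Filter (nbhs (th : prod_topology (fun _ : 'I_M => R))).
      exact: nbhs_filter.
    apply: (@filter_forall _ _
      (fun j (f : prod_topology (fun _ : 'I_M => R)) => `|th j - f j| < dl) _ Fth) => j.
    exact: (@proj_continuous 'I_M (fun _ => R : topologicalType) j th
      (ball (th j) dl) (nbhsx_ballx _ _ d0)).
  have [th' [[sth' hth'] h]] := clth _ _ (ex_intro2 _ _ dl d0 (fun x h => h)) nb.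
  by exists th'.
have sumd (dl : R) th' : (forall j, `|th j - th' j| < dl) ->
    \sum_j `|th j - th' j| <= M%:R * dl.
  move=> h; apply: (@le_trans _ _ (\sum_(j < M) dl)); last first.
    by rewrite sumr_const card_ord mulr_natl.
  by apply: ler_sum => j _; exact: ltW.
have sth : simplex th.
  split.
    move=> j; apply/ler_addgt0Pr => e e0.
    have [th' [[h0 _] _] /(_ j)] := near_th _ e0.
    by rewrite ltr_norml => /andP[h _]; have := h0 j; lra.
  apply/eqP; rewrite -subr_eq0 -normr_le0; apply/ler_addgt0Pr => e e0; rewrite add0r.
  have d0 : 0 < e / (M%:R + 1) by rewrite divr_gt0// ltr_wpDl.
  have [th' [[_ h1] _] hd] := near_th _ d0.
  rewrite -{1}h1 -sumrB (le_trans (ler_norm_sum _ _ _))//.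
  rewrite (le_trans (sumd _ _ hd))// mulrA ler_pdivrMr ?ltr_wpDl//.
  by rewrite mulrDr mulr1 mulrC lerDl ltW.
exists th; split => // th1 sth1.
apply: (@le_trans _ _ (inf V)); last by apply: ge_inf => //; exists th1.
apply/ler_addgt0Pr => e e0.
have d0 : 0 < e / (L * M%:R + 1) by rewrite divr_gt0// ltr_wpDl// mulr_ge0.
have [th' [sth' hV] hd] := near_th _ d0.
have := lipH _ _ sth sth'; rewrite ler_norml => /andP[_ h].
have h2 := ler_wpM2l L0 (sumd _ _ hd).
set dl := e / _ in d0 hV hd h2.
have : dl * (L * M%:R + 1) = e by rewrite divfK// lt0r_neq0// ltr_wpDl// mulr_ge0.
lra.
Qed.

End simplex.

(** * Excess risk of Q-aggregation *)

Section q_aggregation.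
Context d (T : measurableType d) {R : realType} (law : probability T R).
Variables (M n : nat) (F : 'I_M -> T -> R) (D : ('I_M -> R) -> T -> R).
Variables (b Cb Cl nu mu beta : R) (kap : 'I_M -> R).
Implicit Types th : 'I_M -> R.
Hypotheses (b0 : 0 < b) (Cb0 : 0 < Cb) (nu01 : 0 < nu < 1) (mu0 : 0 < mu).
Hypotheses (beta0 : 0 < beta) (n0 : (0 < n)%N).
Hypothesis mF : forall j, measurable_fun setT (F j).
Hypothesis Fb : forall j x, `|F j x| <= b.
Hypothesis mD : forall th, simplex th -> measurable_fun setT (D th).
Hypothesis Db : forall th x, simplex th -> `|D th x| <= 2 * Cb * b.
Hypothesis lipD : forall th th' x, simplex th -> simplex th' ->
  `|D th x - D th' x| <= Cb * `|mix F th x - mix F th' x|.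
Hypothesis cvxD : forall th th' (a : R) x, simplex th -> simplex th' -> 0 < a < 1 ->
  D (fun j => a * th j + (1 - a) * th' j) x
    <= a * D th x + (1 - a) * D th' x
       - Cl / 2 * a * (1 - a) * (mix F th x - mix F th' x) ^+ 2.

Definition vertex (j : 'I_M) : 'I_M -> R := fun k => (k == j)%:R.
(** The variance of [j |-> F j x] under the weights [th], in a form that is linear up to the square
    of the mixture. *)
Definition spread th x := \sum_j th j * F j x ^+ 2 - mix F th x ^+ 2.
Definition qloss th x := (1 - nu) * D th x + nu * \sum_j th j * D (vertex j) x.
Definition prior_pen th := \sum_j th j * kap j.
Definition mean (g : T -> R) := \int[law]_x g x.

Hypothesis cvxN : forall th x, simplex th ->
  D th x <= \sum_j th j * D (vertex j) x - Cl / 2 * spread th x.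
Hypotheses (hmu1 : 5 * mu <= nu * (Cl / 2)) (hmu2 : 5 * mu <= (1 - nu) * (Cl / 2)).

(* The weight 16/15 mu of the spread balances the two exponential moments
   of the empirical process; it is what makes the constants of the
   theorem sufficient. *)
Definition qobj th :=
  mean (fun x => qloss th x + 16 / 15 * mu * spread th x)
  + beta / n%:R * prior_pen th.

Let sv j : simplex (vertex j). Proof. exact: simplex_vertex. Qed.

Lemma bmeas_F j : bmeas (F j).
Proof. by split=> //; exists b. Qed.

Lemma bmeas_D th : simplex th -> bmeas (D th).
Proof. by move=> sth; split; [exact: mD|exists (2 * Cb * b) => x; exact: Db]. Qed.

Lemma bmeas_mix th : bmeas (mix F th).
Proof. by apply: bmeas_sum => j; apply: bmeasZ; exact: bmeas_F. Qed.

Lemma bmeas_spread th : bmeas (spread th).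
Proof.
apply: bmeasB; last by apply: bmeasX; exact: bmeas_mix.
by apply: bmeas_sum => j; apply/bmeasZ/bmeasX; exact: bmeas_F.
Qed.

Lemma bmeas_qloss th : simplex th -> bmeas (qloss th).
Proof.
move=> sth; apply: bmeasD; first by apply: bmeasZ; exact: bmeas_D.
by apply: bmeasZ; apply: bmeas_sum => j; apply: bmeasZ; exact: bmeas_D.
Qed.

Lemma bmeas_qobj th : simplex th ->
  bmeas (fun x => qloss th x + 16 / 15 * mu * spread th x).
Proof.
by move=> sth; apply: bmeasD; [exact: bmeas_qloss|apply: bmeasZ; exact: bmeas_spread].
Qed.

Lemma mix_le th x : simplex th -> `|mix F th x| <= b.
Proof. by move=> sth; exact: simplex_norm_sum_le. Qed.

Lemma mix_convex th th' (a : R) x :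
  mix F (fun j => a * th j + (1 - a) * th' j) x = a * mix F th x + (1 - a) * mix F th' x.
Proof.
by rewrite /mix !mulr_sumr -big_split/=; apply: eq_bigr => j _; ring.
Qed.

Lemma spreadE th x : simplex th ->
  spread th x = \sum_j th j * (F j x - mix F th x) ^+ 2.
Proof.
move=> sth; rewrite /spread.
rewrite [RHS](eq_bigr (fun j => th j * F j x ^+ 2 - (2 * mix F th x) * (th j * F j x)
   + th j * mix F th x ^+ 2)); last by move=> j _; ring.
rewrite big_split/= sumrB -mulr_sumr (simplex_sum_cst _ sth) /mix; ring.
Qed.

Lemma spread_ge0 th x : simplex th -> 0 <= spread th x.
Proof.
move=> sth; rewrite spreadE//; apply: sumr_ge0 => j _.
by rewrite mulr_ge0 ?sqr_ge0// sth.1.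
Qed.

Lemma sum_sqr_mix th (c : R) x : simplex th ->
  \sum_j th j * (F j x - c) ^+ 2 = spread th x + (mix F th x - c) ^+ 2.
Proof.
move=> sth; rewrite /spread.
rewrite (eq_bigr (fun j => th j * F j x ^+ 2 - (2 * c) * (th j * F j x)
   + th j * c ^+ 2)); last by move=> j _; ring.
rewrite big_split/= sumrB -mulr_sumr (simplex_sum_cst _ sth) /mix; ring.
Qed.

(** The term [(1 - nu) * D] contributes a modulus of at least [5 * mu]. The spread is concave, with
    gap exactly [a * (1 - a)] times the squared difference of the mixtures, and takes [16 / 15 * mu]
    of it back. *)
Lemma qobj_convex th th' (a : R) : simplex th -> simplex th' -> 0 < a < 1 ->
  qobj (fun j => a * th j + (1 - a) * th' j) <=
  a * qobj th + (1 - a) * qobj th'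
  - (5 * mu - 16 / 15 * mu) * a * (1 - a) * mean (fun x => (mix F th x - mix F th' x) ^+ 2).
Proof.
move=> sth sth' a01; have /andP[a0 a1] := a01.
have sa : simplex (fun j => a * th j + (1 - a) * th' j).
  by apply: simplex_convex => //; rewrite !ltW.
have bd : bmeas (fun x => (mix F th x - mix F th' x) ^+ 2).
  by apply: bmeasX; apply: bmeasB; exact: bmeas_mix.
have pt x : qloss (fun j => a * th j + (1 - a) * th' j) x
    + 16 / 15 * mu * spread (fun j => a * th j + (1 - a) * th' j) x
  <= a * (qloss th x + 16 / 15 * mu * spread th x)
   + ((1 - a) * (qloss th' x + 16 / 15 * mu * spread th' x)
   + (- ((5 * mu - 16 / 15 * mu) * a * (1 - a))) * (mix F th x - mix F th' x) ^+ 2).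
  have e1 (u : 'I_M -> R) : \sum_j (a * th j + (1 - a) * th' j) * u j
      = a * (\sum_j th j * u j) + (1 - a) * \sum_j th' j * u j.
    by rewrite !mulr_sumr -big_split/=; apply: eq_bigr => j _; ring.
  rewrite /qloss /spread !e1 mix_convex.
  have h := cvxD x sth sth' a01.
  have nu1 : 0 <= 1 - nu by rewrite subr_ge0 ltW//; case/andP: nu01.
  have h1 := ler_wpM2l nu1 h.
  have aa : 0 <= a * (1 - a) * (mix F th x - mix F th' x) ^+ 2.
    by rewrite mulr_ge0 ?sqr_ge0// mulr_ge0 ?subr_ge0// ltW.
  have h2 := ler_wpM2r aa hmu2.
  set A := mix F th x in h1 h2 *; set B := mix F th' x in h1 h2 *.
  rewrite -subr_ge0; rewrite -subr_ge0 in h1; rewrite -subr_ge0 in h2.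
  by apply: le_trans (addr_ge0 h1 h2) _; rewrite le_eqVlt; apply/orP; left;
    apply/eqP; field.
rewrite /qobj.
have -> : prior_pen (fun j => a * th j + (1 - a) * th' j)
    = a * prior_pen th + (1 - a) * prior_pen th'.
  by rewrite /prior_pen !mulr_sumr -big_split/=; apply: eq_bigr => j _; ring.
have bq := bmeas_qobj sth; have bq' := bmeas_qobj sth'.
have := bmeas_le_Rintegral law (bmeas_qobj sa)
  (bmeasD (bmeasZ a bq) (bmeasD (bmeasZ (1 - a) bq')
    (bmeasZ (- ((5 * mu - 16 / 15 * mu) * a * (1 - a))) bd))) pt.
rewrite bmeas_RintegralD ?bmeas_RintegralZ//; [|exact: bmeasZ|
  by apply: bmeasD; exact: bmeasZ].
rewrite bmeas_RintegralD ?bmeas_RintegralZ//; [|exact: bmeasZ|exact: bmeasZ].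
rewrite -!/(mean _); lra.
Qed.

Lemma l1_sum_le th th' (u : 'I_M -> R) (c : R) : (forall j, `|u j| <= c) ->
  `|\sum_j th j * u j - \sum_j th' j * u j| <= c * \sum_j `|th j - th' j|.
Proof.
move=> uc; rewrite -sumrB mulr_sumr (le_trans (ler_norm_sum _ _ _))//.
by apply: ler_sum => j _; rewrite -mulrBl normrM mulrC ler_wpM2r.
Qed.

Lemma qobj_lip : exists L, forall th th', simplex th -> simplex th' ->
  `|qobj th - qobj th'| <= L * \sum_j `|th j - th' j|.
Proof.
pose KK := \sum_j `|kap j|.
exists ((1 - nu) * (Cb * b) + nu * (2 * Cb * b) + 16 / 15 * mu * (b ^+ 2 + 2 * b * b)
   + beta / n%:R * KK) => th th' sth sth'.
set l1 := \sum_j _; have l10 : 0 <= l1 by exact: sumr_ge0.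
have /andP[nu0 nu1] := nu01.
have b00 := ltW b0.
have mixl x : `|mix F th x - mix F th' x| <= b * l1 by exact: l1_sum_le.
have pt x : `|(qloss th x + 16 / 15 * mu * spread th x)
     - (qloss th' x + 16 / 15 * mu * spread th' x)|
   <= ((1 - nu) * (Cb * b) + nu * (2 * Cb * b) + 16 / 15 * mu * (b ^+ 2 + 2 * b * b)) * l1.
  have h1 : `|D th x - D th' x| <= Cb * b * l1.
    by rewrite (le_trans (lipD _ _ _))// -mulrA ler_wpM2l// ltW.
  have h2 : `|\sum_j th j * D (vertex j) x - \sum_j th' j * D (vertex j) x|
      <= 2 * Cb * b * l1 by apply: l1_sum_le => j; exact: Db.
  have h3 : `|\sum_j th j * F j x ^+ 2 - \sum_j th' j * F j x ^+ 2| <= b ^+ 2 * l1.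
    by apply: l1_sum_le => j; rewrite normrX lerXn2r// nnegrE.
  have h4 : `|mix F th x ^+ 2 - mix F th' x ^+ 2| <= 2 * b * b * l1.
    rewrite subr_sqr normrM mulrC -mulrA ler_pM//.
    by rewrite (le_trans (ler_normD _ _))// mulr2n mulrDl mul1r lerD// mix_le.
  rewrite /qloss /spread.
  have k1 : 0 <= 1 - nu by rewrite subr_ge0 ltW.
  have k2 : 0 <= nu by exact: ltW.
  have k3 : 0 <= 16 / 15 * mu by rewrite mulr_ge0// ltW.
  have g1 := ler_wpM2l k1 h1; have g2 := ler_wpM2l k2 h2.
  have g3 := ler_wpM2l k3 h3; have g4 := ler_wpM2l k3 h4.
  rewrite -[X in X * `|_|](ger0_norm k1) -normrM in g1.
  rewrite -[X in X * `|_|](ger0_norm k2) -normrM in g2.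
  rewrite -[X in X * `|_|](ger0_norm k3) -normrM in g3.
  rewrite -[X in X * `|_|](ger0_norm k3) -normrM in g4.
  move: g1 g2 g3 g4; rewrite !ler_norml => /andP[? ?] /andP[? ?] /andP[? ?] /andP[? ?].
  by apply/andP; split; lra.
have bq := bmeas_qobj sth; have bq' := bmeas_qobj sth'.
have g5 : `|beta / n%:R * prior_pen th - beta / n%:R * prior_pen th'| <= beta / n%:R * KK * l1.
  have bn : 0 <= beta / n%:R by rewrite divr_ge0// ltW.
  rewrite -mulrBr normrM (ger0_norm bn) -mulrA ler_wpM2l//.
  apply: l1_sum_le => j; rewrite /KK (bigD1 j)//= lerDl; exact: sumr_ge0.
have : `|mean (fun x => qloss th x + 16 / 15 * mu * spread th x)
     - mean (fun x => qloss th' x + 16 / 15 * mu * spread th' x)|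
   <= ((1 - nu) * (Cb * b) + nu * (2 * Cb * b) + 16 / 15 * mu * (b ^+ 2 + 2 * b * b)) * l1.
  rewrite /mean -bmeas_RintegralB//.
  set c := (X in _ <= X) in pt *.
  rewrite ler_norml -[- c](Rintegral_prob_cst law) -{2}[c](Rintegral_prob_cst law).
  have bb := bmeasB bq bq'.
  apply/andP; split; apply: bmeas_le_Rintegral => //; try exact: bmeas_cst;
    by move=> x; have := pt x; rewrite ler_norml => /andP[].
rewrite /qobj; move: g5; rewrite !ler_norml => /andP[? ?] /andP[? ?].
by apply/andP; split; lra.
Qed.

(** Minimality of [thS] is tested at a point of the segment towards [th]; division by [a] gives the
    bound with a factor [1 - a], and [a] tends to 0. *)
Lemma qobj_quadratic_growth thS th : simplex thS ->
  (forall th', simplex th' -> qobj thS <= qobj th') -> simplex th ->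
  (5 * mu - 16 / 15 * mu) * mean (fun x => (mix F th x - mix F thS x) ^+ 2)
    <= qobj th - qobj thS.
Proof.
move=> sS hS sth; set g := (X in X <= _).
have g0 : 0 <= g.
  rewrite mulr_ge0//; first by have mu0' := mu0; lra.
  by apply: Rintegral_ge0 => x _; rewrite sqr_ge0.
have key (a : R) : 0 < a < 1 -> (1 - a) * g <= qobj th - qobj thS.
  move=> a01; have /andP[a0 a1] := a01.
  have a01' : 0 <= a <= 1 by rewrite !ltW.
  have h := le_trans (hS _ (simplex_convex a01' sth sS)) (qobj_convex sth sS a01).
  by rewrite -(ler_pM2l a0) /g; lra.
apply/ler_addgt0Pr => e e0.
have h1 : 0 < g + e + 1 by lra.
(* This [a] satisfies [a * g <= e] and stays below 1 even for [g = 0]. *)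
have a01 : 0 < e / (g + e + 1) < 1.
  by rewrite divr_gt0//= ltr_pdivrMr// mul1r; lra.
have := key _ a01; set a := e / _.
have : a * g <= e.
  rewrite /a mulrAC ler_pdivrMr//; apply: ler_wpM2l; [exact: ltW|lra].
lra.
Qed.

(** Optimality of [thH] for the empirical criterion is used twice and quadratic growth once; the
    second use is what leaves the penalty of [thH] with a negative sign. The term [nu] of the
    criterion provides, by the convexity gap [cvxN], the negative multiple of the spread of
    [thH]. *)
Lemma excess_risk_le (z : 'I_n -> T) thS thH : simplex thS ->
  (forall th', simplex th' -> qobj thS <= qobj th') -> simplex thH ->
  n%:R^-1 * \sum_(i < n) qloss thH (z i) + beta / n%:R * prior_pen thH
    <= n%:R^-1 * \sum_(i < n) qloss thS (z i) + beta / n%:R * prior_pen thS ->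
  mean (D thH) - qobj thS <=
  2 * ((mean (qloss thH) - n%:R^-1 * \sum_(i < n) qloss thH (z i))
     - (mean (qloss thS) - n%:R^-1 * \sum_(i < n) qloss thS (z i)))
  - (5 * mu - 16 / 15 * mu)
     * (mean (spread thH) + mean (fun x => (mix F thH x - mix F thS x) ^+ 2))
  - 2 * (16 / 15 * mu) * mean (spread thS) - beta / n%:R * prior_pen thH.
Proof.
move=> sS hS sH emp; have /andP[nu0 nu1] := nu01.
have h1 := qobj_quadratic_growth sS hS sH.
have h2 : mean (D thH) + 5 * mu * mean (spread thH) <= mean (qloss thH).
  rewrite /mean -bmeas_RintegralZ; last exact: bmeas_spread.
  have b1 := bmeas_D sH; have b2 := bmeasZ (5 * mu) (bmeas_spread thH).
  rewrite -bmeas_RintegralD//.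
  apply: bmeas_le_Rintegral; [exact: bmeasD|exact: bmeas_qloss|move=> x].
  have h := cvxN x sH; have v0 := spread_ge0 x sH.
  have k1 := ler_wpM2l (ltW nu0) h; have k2 := ler_wpM2r v0 hmu1.
  rewrite /qloss; lra.
have split_qobj th : simplex th -> qobj th = mean (qloss th)
    + 16 / 15 * mu * mean (spread th) + beta / n%:R * prior_pen th.
  move=> sth; rewrite /qobj /mean bmeas_RintegralD ?bmeas_RintegralZ//.
  - exact: bmeas_spread.
  - exact: bmeas_qloss.
  - by apply: bmeasZ; exact: bmeas_spread.
rewrite !split_qobj// in h1 *; lra.
Qed.

(** * Exponential moments over the sample *)

Context {dO : measure_display} {Omega : measurableType dO}.
Variables (P : probability Omega R) (Z : 'I_n -> Omega -> T).
Hypothesis iidZ : iid_sample P law Z.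
Hypothesis kap1 : \sum_j expR (- kap j) = 1.
Hypothesis hA : 12 * Cb ^+ 2 * (1 - nu) ^+ 2 <= mu * beta.
Hypothesis hA' : 108 * b * Cb * (1 - nu) <= beta.
Hypothesis hB : 3 * Cb * nu * (nu * Cb + 4 * mu * b) <= 2 * mu * beta.
Variable thS : 'I_M -> R.
Hypothesis sS : simplex thS.

(* A: nonlinear part, of weight 3/8; B: linear part, of weight 5/8. *)
Let gA th x := 16 * (1 - nu) / (3 * beta) * (D th x - D thS x).
Let eA j := mean (fun x => (F j x - mix F thS x) ^+ 2).
Let vA j := - (8 * n%:R / (3 * beta) * (9 / 5 * mu) * eA j) - kap j.
Let GB j x := D (vertex j) x - \sum_k thS k * D (vertex k) x.
Let gB j x := 16 * nu / (5 * beta) * (mean (GB j) - GB j x).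
(** The second moment of [F j - F k] for [k] drawn from [thS]. It controls the variance of [GB j]
    and equals [eA j] plus the mean spread of [thS], because the linear part is centred at the
    averaged loss, not at the loss of the mixture. The spread in the objective of [thS] produces the
    negative term that pays for it. *)
Let sB j := mean (fun x => \sum_k thS k * (F j x - F k x) ^+ 2).
Let vB j := - (8 * n%:R / (5 * beta) * (32 / 15 * mu) * sB j) - kap j.

(** The process vanishes at [thS] and is Lipschitz in the mixture, so contraction compares it with
    [2 * c * Cb] times the difference of the mixtures, which is linear with vertex values [a j]. The
    cosh bound at each vertex is compensated by the term [eA j] of [vA j], and the prior weights
    remain. *)
Lemma nonlinear_moment_le1 (S : finType) (net : S -> 'I_M -> R) :
  (forall s, simplex (net s)) ->
  (\int[P]_w (expmax (fun s => \sum_j net s j * vA j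
     + \sum_(i < n) (mean (gA (net s)) - gA (net s) (Z i w)))%R)%:E <= 1)%E.
Proof.
move=> snet; have /andP[nu0 nu1] := nu01.
have Cb0' := Cb0; have beta0' := beta0; have b0' := b0; have mu0' := mu0.
have nu1' : 0 < 1 - nu by rewrite subr_gt0.
pose c := 16 * (1 - nu) / (3 * beta).
have c0 : 0 < c by rewrite divr_gt0// mulr_gt0.
pose a j x := 2 * c * Cb * (F j x - mix F thS x).
have ba j : bmeas (a j) by apply/bmeasZ/bmeasB; [exact: bmeas_F|exact: bmeas_mix].
have c2 : 0 <= 2 * c by rewrite mulr_ge0// ltW.
have tE s x : \sum_j net s j * a j x = 2 * c * Cb * (mix F (net s) x - mix F thS x).
  rewrite (eq_bigr (fun j => 2 * c * Cb * (net s j * F j x)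
    - net s j * (2 * c * Cb * mix F thS x))); last by move=> j _; rewrite /a; ring.
  by rewrite sumrB -mulr_sumr simplex_sum_cst//; rewrite /mix; ring.
have lip th th' x : simplex th -> simplex th' ->
    `|2 * gA th x - 2 * gA th' x| <= `|2 * c * Cb * (mix F th x - mix F th' x)|.
  move=> sth sth'; rewrite (_ : _ - _ = 2 * c * (D th x - D th' x)); last first.
    by rewrite /gA -/c; ring.
  rewrite [X in _ <= `|X|](_ : _ = 2 * c * (Cb * (mix F th x - mix F th' x))); last by ring.
  rewrite [leLHS]normrM [leRHS]normrM ler_wpM2l// normrM (ger0_norm (ltW Cb0)).
  exact: lipD.
apply: le_trans.
  apply: (iid_radexp iidZ (g := fun s => gA (net s))
    (t := fun s x => \sum_j net s j * a j x)).
  - by move=> s; apply/bmeasZ/bmeasB; exact: bmeas_D.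
  - move=> s; have [] : bmeas (fun x => \sum_j net s j * a j x) by
      apply: bmeas_sum => j; exact: bmeasZ.
    by [].
  - move=> s x; rewrite tE; have := lip _ _ x (snet s) sS.
    by rewrite {2}/gA subrr mulr0 mulr0 subr0.
  - move=> s s' x; rewrite !tE [X in _ <= `|X|](_ : _ =
      2 * c * Cb * (mix F (net s) x - mix F (net s') x)); last by ring.
    exact: lip.
apply: (le_trans (radexp_linear_le _ _ _ n (v := vA) ba _)) => //.
- by move=> s j; exact: (snet s).1.
- by move=> s; exact: (snet s).2.
rewrite lee_fin -[leRHS]kap1; apply: ler_sum => j _.
(* By [hA'] the bound is 64 / (3 * 108), just below 1/5. *)
have a5 x : `|a j x| <= 1 / 5.
  rewrite /a normrM ger0_norm; last by rewrite mulr_ge0// ltW.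
  have h2b : `|F j x - mix F thS x| <= 2 * b.
    rewrite (le_trans (ler_normB _ _))// mulr2n mulrDl mul1r lerD//.
    exact: mix_le.
  apply: (@le_trans _ _ (2 * c * Cb * (2 * b))).
    by rewrite ler_wpM2l// mulr_ge0// ltW.
  rewrite /c (_ : _ * (2 * b) = 64 * (b * Cb * (1 - nu)) / (3 * beta)); last first.
    by field; rewrite lt0r_neq0.
  rewrite ler_pdivrMr ?mulr_gt0//; have := hA'; nra.
have e0 : 0 <= eA j by apply: Rintegral_ge0 => x _; exact: sqr_ge0.
pose r := (2 * c * Cb) ^+ 2 / 2 * (1 + 1 / 200) * eA j.
have qr : \int[law]_x ((expR (a j x) + expR (- a j x)) / 2) <= expR r.
  apply: le_trans (expR_ge1Dx r).
  have be : bmeas (fun x => (F j x - mix F thS x) ^+ 2).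
    by apply/bmeasX/bmeasB; [exact: bmeas_F|exact: bmeas_mix].
  have -> : 1 + r = \int[law]_x (1 + (2 * c * Cb) ^+ 2 / 2 * (1 + 1 / 200)
      * (F j x - mix F thS x) ^+ 2).
    rewrite bmeas_RintegralD ?bmeas_RintegralZ ?Rintegral_prob_cst//.
    - exact: bmeas_cst.
    - exact: bmeasZ.
  apply: bmeas_le_Rintegral => [||x].
  - under eq_fun do rewrite mulrC.
    by apply/bmeasZ/bmeasD; [exact: bmeas_expR|exact/bmeas_expR/bmeasN].
  - by apply: bmeasD; [exact: bmeas_cst|exact: bmeasZ].
  - apply: le_trans (cosh_le (a5 x)) _; rewrite /a lerD2l.
    by rewrite le_eqVlt; apply/orP; left; apply/eqP; ring.
have q0 : 0 <= \int[law]_x ((expR (a j x) + expR (- a j x)) / 2).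
  by apply: Rintegral_ge0 => x _; rewrite divr_ge0// addr_ge0 ?expR_ge0.
apply: (@le_trans _ _ (expR (vA j) * expR r ^+ n)).
  by rewrite ler_wpM2l ?expR_ge0// lerXn2r// ?nnegrE ?expR_ge0.
rewrite -expRM_natr -expRD ler_expR /vA -lerBrDr [leRHS](_ : _ = - (r * n%:R) - kap j);
  last ring.
rewrite lerD2r lerN2 /r.
(* After multiplication by [beta ^+ 2], [hA] reduces this to 512 * 201 / (9 * 200 * 12), about
   4.764, being at most 24/5. *)
suff h : (2 * c * Cb) ^+ 2 / 2 * (1 + 1 / 200) <= 8 / (3 * beta) * (9 / 5 * mu).
  have ne : 0 <= eA j * n%:R by rewrite mulr_ge0.
  have := ler_wpM2r ne h; lra.
rewrite /c (_ : (2 * _ * Cb) ^+ 2 / 2 * (1 + 1 / 200) =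
    (512 * 201 / 9 / 200 * (Cb ^+ 2 * (1 - nu) ^+ 2)) / (beta * beta)); last first.
  by field; rewrite lt0r_neq0.
rewrite ler_pdivrMr ?mulr_gt0//.
rewrite (_ : 8 / (3 * beta) * (9 / 5 * mu) * (beta * beta) = 24 / 5 * (mu * beta)); last first.
  by field; rewrite lt0r_neq0.
have := hA; have : 0 <= Cb ^+ 2 * (1 - nu) ^+ 2 by rewrite mulr_ge0 ?sqr_ge0.
lra.
Qed.

(** At each vertex Bernstein's inequality bounds the moment of the centred [GB j] by its second
    moment, at most [Cb ^+ 2 * sB j], and the negative term of [vB j] compensates it. *)
Lemma linear_moment_le1 :
  (\int[P]_w (\sum_j expR (vB j + \sum_(i < n) gB j (Z i w)))%:E <= 1)%E.
Proof.
have /andP[nu0 nu1] := nu01.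
have Cb0' := Cb0; have beta0' := beta0; have b0' := b0; have mu0' := mu0.
pose c := 16 * nu / (5 * beta).
have c0 : 0 < c by rewrite divr_gt0// mulr_gt0.
have bV j : bmeas (D (vertex j)) by exact: bmeas_D.
have bG j : bmeas (GB j) by apply: bmeasB => //; apply: bmeas_sum => k; exact: bmeasZ.
have bg j : bmeas (gB j) by apply/bmeasZ/bmeasB => //; exact: bmeas_cst.
apply: le_trans (iid_sum_expR iidZ vB bg) _.
rewrite lee_fin -[leRHS]kap1; apply: ler_sum => j _.
have FjFk j' k x : `|F j' x - F k x| <= 2 * b.
  by rewrite (le_trans (ler_normB _ _))// mulr2n mulrDl mul1r lerD.
have mixV j' x : mix F (vertex j') x = F j' x by rewrite /mix sum_vertex.
have GE x : GB j x = \sum_k thS k * (D (vertex j) x - D (vertex k) x).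
  by under eq_bigr do rewrite mulrBr; rewrite sumrB simplex_sum_cst.
have DD k x : `|D (vertex j) x - D (vertex k) x| <= Cb * `|F j x - F k x|.
  by have := lipD x (sv j) (sv k); rewrite !mixV.
have Gb x : `|GB j x| <= Cb * (2 * b).
  rewrite GE; apply: simplex_norm_sum_le => // k.
  by apply: le_trans (DD k x) _; rewrite ler_wpM2l// ltW.
pose w x := \sum_k thS k * (F j x - F k x) ^+ 2.
have bw : bmeas w.
  by apply: bmeas_sum => k; apply/bmeasZ/bmeasX/bmeasB; exact: bmeas_F.
have w0 x : 0 <= w x.
  by apply: sumr_ge0 => k _; rewrite mulr_ge0 ?sqr_ge0// sS.1.
have G2 x : GB j x ^+ 2 <= Cb ^+ 2 * w x.
  have jensen (u : 'I_M -> R) : (\sum_k thS k * u k) ^+ 2 <= \sum_k thS k * u k ^+ 2.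
    rewrite -subr_ge0 (_ : _ - _ = \sum_k thS k * (u k - \sum_k thS k * u k) ^+ 2).
      by apply: sumr_ge0 => k _; rewrite mulr_ge0 ?sqr_ge0// sS.1.
    set m := \sum_k thS k * u k.
    rewrite [RHS](eq_bigr (fun k => thS k * u k ^+ 2 - (2 * m) * (thS k * u k)
      + thS k * m ^+ 2)); last by move=> k _; ring.
    by rewrite big_split/= sumrB -mulr_sumr simplex_sum_cst// -/m; ring.
  rewrite GE (le_trans (jensen _))// mulr_sumr; apply: ler_sum => k _.
  rewrite [leRHS]mulrCA; apply: ler_wpM2l; first exact: sS.1.
  rewrite -exprMn -[leLHS]real_normK ?num_real//.
  rewrite -[leRHS]real_normK ?num_real// lerXn2r// ?nnegrE//.
  by rewrite normrM (ger0_norm (ltW Cb0)).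
pose C := c * (Cb * (2 * b)).
have mbeta : 0 < mu * beta by rewrite mulr_gt0.
have nC : 0 < nu * Cb by rewrite mulr_gt0.
have hB' : 3 / 2 * (nu * Cb) ^+ 2 + 6 * mu * b * (nu * Cb) <= mu * beta.
  by have := hB; lra.
have CE : C * (mu * beta) = 32 / 5 * (mu * b * (nu * Cb)).
  by rewrite /C /c; field; rewrite lt0r_neq0.
have mub : 0 < mu * b * (nu * Cb) by rewrite !mulr_gt0.
have C3 : C < 3.
  rewrite -(ltr_pM2r mbeta) CE; have := sqr_ge0 (nu * Cb); lra.
have C30 : 0 < 1 - C / 3 by lra.
have s0 : 0 <= sB j by apply: Rintegral_ge0 => x _; exact: w0.
pose r := c ^+ 2 * Cb ^+ 2 / (2 * (1 - C / 3)) * sB j.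
have bmn : bmeas (fun x => expR (- (c * GB j x))).
  by apply/bmeas_expR/bmeasN; exact: bmeasZ.
have mr : \int[law]_x expR (- (c * GB j x)) <= 1 - c * mean (GB j) + r.
  have -> : 1 - c * mean (GB j) + r = \int[law]_x ((1 + (- c) * GB j x)
      + c ^+ 2 * Cb ^+ 2 / (2 * (1 - C / 3)) * w x).
    rewrite bmeas_RintegralD ?bmeas_RintegralZ//; last 2 first.
    - by apply: bmeasD; [exact: bmeas_cst|exact: bmeasZ].
    - exact: bmeasZ.
    rewrite bmeas_RintegralD ?bmeas_RintegralZ ?Rintegral_prob_cst//; last 2 first.
    - exact: bmeas_cst.
    - exact: bmeasZ.
    by rewrite mulNr.
  apply: bmeas_le_Rintegral => // [|x].
    apply: bmeasD; last exact: bmeasZ.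
    by apply: bmeasD; [exact: bmeas_cst|exact: bmeasZ].
  have hC : `|- (c * GB j x)| <= C.
    by rewrite normrN normrM (ger0_norm (ltW c0)) ler_wpM2l// ltW.
  apply: le_trans (expR_bernstein hC C3) _.
  rewrite mulNr lerD2l sqrrN exprMn.
  rewrite [leRHS](_ : _ = c ^+ 2 * (Cb ^+ 2 * w x) / (2 * (1 - C / 3))); last by ring.
  apply: ler_wpM2r; first by rewrite invr_ge0 mulr_ge0// ltW.
  by rewrite ler_wpM2l ?sqr_ge0.
have qr : \int[law]_x expR (gB j x) <= expR r.
  have -> : \int[law]_x expR (gB j x) =
      expR (c * mean (GB j)) * \int[law]_x expR (- (c * GB j x)).
    rewrite -bmeas_RintegralZ//; apply: eq_Rintegral => x _.
    by rewrite -expRD; congr expR; rewrite /gB -/c; ring.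
  rewrite -[leRHS](_ : expR (c * mean (GB j)) * expR (r - c * mean (GB j)) = _); last first.
    by rewrite -expRD; congr expR; ring.
  rewrite ler_wpM2l ?expR_ge0// (le_trans mr)//.
  by apply: le_trans (expR_ge1Dx _); lra.
have q0 : 0 <= \int[law]_x expR (gB j x).
  by apply: Rintegral_ge0 => x _; exact: expR_ge0.
apply: (@le_trans _ _ (expR (vB j) * expR r ^+ n)).
  by rewrite ler_wpM2l ?expR_ge0// lerXn2r// ?nnegrE ?expR_ge0.
rewrite -expRM_natr -expRD ler_expR /vB -lerBrDr [leRHS](_ : _ = - (r * n%:R) - kap j);
  last ring.
rewrite lerD2r lerN2 /r.
(* The variance term of [hB'] is matched exactly, as (256/25) / (512/75) = 3/2. The correction
   [C / 3] costs 32/15 of [mu * b * (nu * Cb)], of which [hB'] provides 6. *)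
suff h : c ^+ 2 * Cb ^+ 2 / (2 * (1 - C / 3)) <= 8 / (5 * beta) * (32 / 15 * mu).
  have ne : 0 <= sB j * n%:R by rewrite mulr_ge0.
  have := ler_wpM2r ne h; lra.
rewrite ler_pdivrMr ?mulr_gt0//.
have bb : 0 < beta * beta by rewrite mulr_gt0.
rewrite -(ler_pM2r bb).
rewrite (_ : c ^+ 2 * Cb ^+ 2 * (beta * beta) = 256 / 25 * (nu * Cb) ^+ 2); last first.
  by rewrite /c; field; rewrite lt0r_neq0.
rewrite (_ : 8 / (5 * beta) * (32 / 15 * mu) * (2 * (1 - C / 3)) * (beta * beta)
   = 512 / 75 * (mu * beta - C * (mu * beta) / 3)); last first.
  by field; rewrite lt0r_neq0.
by rewrite CE; lra.
Qed.

Let EA th w := \sum_j th j * vA j + \sum_(i < n) (mean (gA th) - gA th (Z i w)).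
Let EB th w := \sum_j th j * (vB j + \sum_(i < n) gB j (Z i w)).
Let l1A := \sum_j `|vA j| + n%:R * (2 * (16 * (1 - nu) / (3 * beta) * (Cb * b))).

(** The modulus [l1A] may grow with [n]: it only multiplies the mesh of the net, which tends to
    0. *)
Lemma EA_lip th th' w : simplex th -> simplex th' ->
  EA th w <= EA th' w + l1A * \sum_j `|th j - th' j|.
Proof.
move=> sth sth'; have /andP[nu0 nu1] := nu01.
set l1 := \sum_j `|th j - _|.
have nu1' : 0 < 1 - nu by rewrite subr_gt0.
pose c := 16 * (1 - nu) / (3 * beta).
have c0 : 0 < c by rewrite divr_gt0// mulr_gt0.
have h1 : `|\sum_j th j * vA j - \sum_j th' j * vA j| <= (\sum_j `|vA j|) * l1.
  apply: l1_sum_le => j; rewrite [leRHS](bigD1 j)//= lerDl; exact: sumr_ge0.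
have h2 x : `|gA th x - gA th' x| <= c * (Cb * b) * l1.
  rewrite (_ : _ - _ = c * (D th x - D th' x)); last by rewrite /gA -/c; ring.
  rewrite normrM (ger0_norm (ltW c0)) [leRHS](_ : _ = c * (Cb * (b * l1))); last by ring.
  apply: ler_wpM2l; first exact: ltW.
  apply: le_trans (lipD x sth sth') _; apply: ler_wpM2l; first exact: ltW.
  exact: l1_sum_le.
have bgA t : simplex t -> bmeas (gA t).
  by move=> st; apply/bmeasZ/bmeasB; exact: bmeas_D.
have h3 : mean (gA th) - mean (gA th') <= c * (Cb * b) * l1.
  rewrite -bmeas_RintegralB; [|exact: bgA|exact: bgA].
  rewrite -[leRHS](Rintegral_prob_cst law).
  apply: bmeas_le_Rintegral; [|exact: bmeas_cst|].
    by apply: bmeasB; exact: bgA.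
  by move=> x; apply: le_trans (ler_norm _) (h2 x).
have h4 : \sum_(i < n) (mean (gA th) - gA th (Z i w))
    - \sum_(i < n) (mean (gA th') - gA th' (Z i w)) <= n%:R * (2 * (c * (Cb * b))) * l1.
  rewrite -sumrB; apply: (@le_trans _ _ (\sum_(i < n) (2 * (c * (Cb * b)) * l1))).
    apply: ler_sum => i _; have := h2 (Z i w); rewrite ler_norml => /andP[? ?]; lra.
  by rewrite sumr_const card_ord -[leLHS]mulr_natl [leLHS]mulrA.
move: h1; rewrite ler_norml => /andP[_ h1].
by rewrite /EA /l1A -/c; lra.
Qed.

(** Bookkeeping of the split: the factor 2 of the process is 3/8 * 16/3 and 5/8 * 16/5, the modulus
    5 - 16/15 is 9/5 + 32/15, and the penalty is shared as 3/8 + 5/8. The spread of [thS] goes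
    entirely to the linear part. *)
Lemma excess_riskE thH w : simplex thH ->
  n%:R / beta * (2 * ((mean (qloss thH) - n%:R^-1 * \sum_(i < n) qloss thH (Z i w))
     - (mean (qloss thS) - n%:R^-1 * \sum_(i < n) qloss thS (Z i w)))
  - (5 * mu - 16 / 15 * mu)
     * (mean (spread thH) + mean (fun x => (mix F thH x - mix F thS x) ^+ 2))
  - 2 * (16 / 15 * mu) * mean (spread thS) - beta / n%:R * prior_pen thH)
  = 3 / 8 * EA thH w + 5 / 8 * EB thH w.
Proof.
move=> sH.
have bV j : bmeas (D (vertex j)) by exact: bmeas_D.
have bF j : bmeas (F j) by exact: bmeas_F.
have qE th : simplex th -> mean (qloss th) =
    (1 - nu) * mean (D th) + nu * \sum_j th j * mean (D (vertex j)).
  move=> sth; rewrite /mean bmeas_RintegralD; last 2 first.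
  - by apply: bmeasZ; exact: bmeas_D.
  - by apply/bmeasZ/bmeas_sum => j; exact: bmeasZ.
  rewrite !bmeas_RintegralZ; [|exact: bmeas_D|by apply: bmeas_sum => j; exact: bmeasZ].
  rewrite bmeas_Rintegral_sum; last by move=> j; exact: bmeasZ.
  by congr (_ + _ * _); apply: eq_bigr => j _; rewrite bmeas_RintegralZ.
have qS th : \sum_(i < n) qloss th (Z i w) = (1 - nu) * (\sum_(i < n) D th (Z i w))
    + nu * \sum_j th j * \sum_(i < n) D (vertex j) (Z i w).
  rewrite /qloss big_split/= -!mulr_sumr exchange_big/=; congr (_ + _ * _).
  by apply: eq_bigr => j _; rewrite mulr_sumr.
have eAE : \sum_j thH j * eA j
    = mean (spread thH) + mean (fun x => (mix F thH x - mix F thS x) ^+ 2).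
  rewrite /mean -bmeas_RintegralD; last 2 first.
  - exact: bmeas_spread.
  - by apply/bmeasX/bmeasB; exact: bmeas_mix.
  under [RHS]eq_Rintegral do rewrite -sum_sqr_mix//.
  have be j : bmeas (fun x => (F j x - mix F thS x) ^+ 2).
    by apply/bmeasX/bmeasB => //; exact: bmeas_mix.
  rewrite bmeas_Rintegral_sum; last by move=> j; exact: bmeasZ.
  by apply: eq_bigr => j _; rewrite bmeas_RintegralZ.
have sBE j : sB j = mean (spread thS) + eA j.
  rewrite /eA /mean -bmeas_RintegralD; last 2 first.
  - exact: bmeas_spread.
  - by apply/bmeasX/bmeasB => //; exact: bmeas_mix.
  apply: eq_Rintegral => x _.
  rewrite (_ : (F j x - _) ^+ 2 = (mix F thS x - F j x) ^+ 2); last by ring.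
  by rewrite -sum_sqr_mix//; apply: eq_bigr => k _; congr (_ * _); ring.
have gAE : mean (gA thH) = 16 * (1 - nu) / (3 * beta) * (mean (D thH) - mean (D thS)).
  rewrite /mean bmeas_RintegralZ ?bmeas_RintegralB//; try exact: bmeas_D.
  by apply: bmeasB; exact: bmeas_D.
have GBE j : mean (GB j) = mean (D (vertex j)) - \sum_k thS k * mean (D (vertex k)).
  rewrite /mean bmeas_RintegralB//; last by apply: bmeas_sum => k; exact: bmeasZ.
  rewrite bmeas_Rintegral_sum; last by move=> k; exact: bmeasZ.
  by congr (_ - _); apply: eq_bigr => k _; rewrite bmeas_RintegralZ.
have vAE : \sum_j thH j * vA j = - (8 * n%:R / (3 * beta) * (9 / 5 * mu)
    * \sum_j thH j * eA j) - prior_pen thH.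
  rewrite /prior_pen mulr_sumr -sumrN -sumrB; apply: eq_bigr => j _; rewrite /vA; ring.
have vBE : \sum_j thH j * vB j = - (8 * n%:R / (5 * beta) * (32 / 15 * mu)
    * (mean (spread thS) + \sum_j thH j * eA j)) - prior_pen thH.
  rewrite /prior_pen -{1}(simplex_sum_cst (mean (spread thS)) sH) -big_split/=.
  rewrite mulr_sumr -sumrN -sumrB; apply: eq_bigr => j _; rewrite /vB sBE; ring.
have gAS : \sum_(i < n) (mean (gA thH) - gA thH (Z i w)) =
    16 * (1 - nu) / (3 * beta) * (n%:R * (mean (D thH) - mean (D thS))
     - (\sum_(i < n) D thH (Z i w) - \sum_(i < n) D thS (Z i w))).
  rewrite sumrB sumr_const card_ord gAE -(mulr_natl _ n) -[\sum_(i < n) gA _ _]mulr_sumr sumrB.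
  ring.
have gBS : \sum_j thH j * (\sum_(i < n) gB j (Z i w)) = 16 * nu / (5 * beta) *
    (n%:R * (\sum_j thH j * mean (D (vertex j)) - \sum_j thS j * mean (D (vertex j)))
     - (\sum_j thH j * \sum_(i < n) D (vertex j) (Z i w)
        - \sum_j thS j * \sum_(i < n) D (vertex j) (Z i w))).
  have e1 j : \sum_(i < n) gB j (Z i w) = 16 * nu / (5 * beta) * (n%:R * mean (GB j)
      - (\sum_(i < n) D (vertex j) (Z i w)
         - \sum_k thS k * \sum_(i < n) D (vertex k) (Z i w))).
    rewrite -mulr_sumr sumrB sumr_const card_ord; congr (_ * (_ - _)).
      by rewrite mulr_natl.
    rewrite /GB sumrB exchange_big/=; congr (_ - _).
    by apply: eq_bigr => k _; rewrite mulr_sumr.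
  under eq_bigr do rewrite e1 GBE.
  set A := \sum_k thS k * mean _; set B := \sum_k thS k * \sum_(i < n) _.
  rewrite (eq_bigr (fun j => 16 * nu / (5 * beta) * (n%:R * (thH j * mean (D (vertex j)))
    - thH j * (n%:R * A) - (thH j * (\sum_(i < n) D (vertex j) (Z i w)) - thH j * B))));
    last by move=> j _; ring.
  rewrite -mulr_sumr !sumrB -mulr_sumr !simplex_sum_cst//; ring.
have EBE : EB thH w = \sum_j thH j * vB j + \sum_j thH j * (\sum_(i < n) gB j (Z i w)).
  by rewrite -big_split/=; apply: eq_bigr => j _; rewrite mulrDr.
rewrite EBE /EA vAE vBE gAS gBS !qE// !qS eAE.
have nn : n%:R != 0 :> R by rewrite pnatr_eq0 -lt0n.
by field; rewrite nn lt0r_neq0.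
Qed.

(** Replacing [thH] by a point of a net of mesh [e] costs a factor that tends to 1 with [e], while
    the left side does not depend on [e]. Only the nonlinear part needs the net; the linear part is
    bounded by the vertices directly. *)
Lemma exp_excess_risk_le1 (thH : Omega -> 'I_M -> R) :
  (forall th', simplex th' -> qobj thS <= qobj th') ->
  (forall w, simplex (thH w)) ->
  measurable_fun setT (fun w => mean (D (thH w))) ->
  (\forall w \ae P,
     n%:R^-1 * \sum_(i < n) qloss (thH w) (Z i w) + beta / n%:R * prior_pen (thH w)
     <= n%:R^-1 * \sum_(i < n) qloss thS (Z i w) + beta / n%:R * prior_pen thS) ->
  (\int[P]_w (expR (n%:R / beta * (mean (D (thH w)) - qobj thS)))%:E <= 1)%E.
Proof.
move=> hS sH mH emp.
have l1A0 : 0 <= l1A.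
  have /andP[nu0 nu1] := nu01.
  rewrite addr_ge0 ?sumr_ge0// mulr_ge0// mulr_ge0// mulr_ge0//; last first.
    by rewrite mulr_ge0// ltW.
  by rewrite divr_ge0// mulr_ge0// ?subr_ge0 ltW.
have bound (e : R) : 0 < e ->
    (\int[P]_w (expR (n%:R / beta * (mean (D (thH w)) - qobj thS)))%:E
      <= (expR (l1A * (M%:R * e)))%:E)%E.
  move=> e0; have [S [net [snet cov]]] := simplex_net e0 sS.
  have mZ i : measurable_fun setT (Z i) by have [] := iidZ.
  pose u1 w := expmax (fun s => EA (net s) w).
  pose u2 w := \sum_j expR (vB j + \sum_(i < n) gB j (Z i w)).
  have mu1 : measurable_fun setT u1.
    apply: (measurable_expmax (H := fun s w => EA (net s) w)) => s.
    apply: measurable_funD => //; apply: measurable_sum => i.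
    apply: measurable_funB => //.
    have [mg _] : bmeas (gA (net s)) by apply/bmeasZ/bmeasB; exact: bmeas_D.
    exact: measurableT_comp mg (mZ i).
  have mu2 : measurable_fun setT u2.
    apply: measurable_sum => j; apply: (measurableT_comp (@measurable_expR R)).
    apply: measurable_funD => //; apply: measurable_sum => i.
    have [mg _] : bmeas (gB j).
      apply/bmeasZ/bmeasB; first exact: bmeas_cst.
      by apply: bmeasB; [exact: bmeas_D|apply: bmeas_sum => k; apply: bmeasZ; exact: bmeas_D].
    exact: measurableT_comp mg (mZ i).
  have u10 w : 0 <= u1 w by exact: expmax_ge0.
  have u20 w : 0 <= u2 w by apply: sumr_ge0 => j _; exact: expR_ge0.
  set E := expR (l1A * (M%:R * e)).
  have E0 : 0 <= E by exact: expR_ge0.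
  have E1 : 1 <= E.
    by rewrite -expR0 ler_expR mulr_ge0// mulr_ge0// ltW.
  have m1 : measurable_fun setT (fun w => (3 / 8 * E)%:E * (u1 w)%:E)%E.
    by apply: emeasurable_funM => //; exact/measurable_EFinP.
  have m2 : measurable_fun setT (fun w => (5 / 8)%:E * (u2 w)%:E)%E.
    by apply: emeasurable_funM => //; exact/measurable_EFinP.
  apply: (@le_trans _ _ (\int[P]_w ((3 / 8 * E)%:E * (u1 w)%:E + (5 / 8)%:E * (u2 w)%:E))%E).
    apply: ae_ge0_le_integral => //.
    - apply/measurable_EFinP; apply: (measurableT_comp (@measurable_expR R)).
      by apply: measurable_funM => //; exact: measurable_funB.
    - move=> w _; rewrite adde_ge0// mule_ge0// lee_fin//.
      by rewrite mulr_ge0.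
    - exact: emeasurable_funD.
    apply: filterS emp => w hw _.
    rewrite -!EFinM -EFinD lee_fin.
    have nb : 0 < n%:R / beta by rewrite divr_gt0// ltr0n.
    have h1 := excess_risk_le (sS) hS (sH w) hw.
    rewrite -(ler_pM2l nb) excess_riskE// in h1.
    have h2 : expR (EA (thH w) w) <= E * u1 w.
      have [s hs] := cov _ (sH w).
      apply: (@le_trans _ _ (E * expR (EA (net s) w))); last first.
        by rewrite ler_wpM2l//; exact: (le_expmax (fun s => EA (net s) w)).
      rewrite /E -expRD ler_expR addrC (le_trans (EA_lip w (sH w) (snet s)))// lerD2l.
      rewrite ler_wpM2l//; apply: (@le_trans _ _ (\sum_(j < M) e)); last first.
        by rewrite sumr_const card_ord mulr_natl.
      exact: ler_sum.
    have h3 : expR (EB (thH w) w) <= u2 w.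
      exact: expR_sum_le (sH w).1 (sH w).2.
    set A := EA _ w in h1 h2; set B := EB _ w in h1 h3.
    have h4 : expR (3 / 8 * A + 5 / 8 * B) <= 3 / 8 * expR A + 5 / 8 * expR B.
      set m := 3 / 8 * A + 5 / 8 * B.
      have tang x : expR m * (1 + (x - m)) <= expR x.
        rewrite -[leRHS](_ : expR m * expR (x - m) = _); last first.
          by rewrite -expRD; congr expR; ring.
        by rewrite ler_wpM2l ?expR_ge0// expR_ge1Dx.
      have := tang A; have := tang B; rewrite /m; lra.
    apply: le_trans (_ : expR (3 / 8 * A + 5 / 8 * B) <= _); first by rewrite ler_expR.
    lra.
  rewrite ge0_integralD//; last 2 first.
  - by move=> w _; rewrite mule_ge0// lee_fin// mulr_ge0.
  - by move=> w _; rewrite mule_ge0// lee_fin.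
  have m1' : measurable_fun setT (fun w => (u1 w)%:E) by apply/measurable_EFinP.
  have m2' : measurable_fun setT (fun w => (u2 w)%:E) by apply/measurable_EFinP.
  have E38 : 0 <= 3 / 8 * E by rewrite mulr_ge0.
  have f1 w : (0 <= (u1 w)%:E)%E by rewrite lee_fin.
  have f2 w : (0 <= (u2 w)%:E)%E by rewrite lee_fin.
  rewrite !ge0_integralZl_EFin//.
  have i1 := nonlinear_moment_le1 snet; have i2 := linear_moment_le1.
  apply: (@le_trans _ _ ((3 / 8 * E)%:E * 1 + (5 / 8)%:E * 1)%E).
    by apply: leeD; apply: lee_wpmul2l => //; rewrite lee_fin.
  by rewrite !mule1 -EFinD lee_fin; lra.
apply/lee_addgt0Pr => e e0.
(* With this mesh the factor is at most [1 + e]; the summand 1 in the denominator excludes division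
   by 0. *)
pose d0 := ln (1 + e) / (l1A * M%:R + 1).
have den : 0 < l1A * M%:R + 1 by rewrite ltr_wpDl// mulr_ge0.
have ln0 : 0 < ln (1 + e) by rewrite ln_gt0// ltrDl.
have d00 : 0 < d0 by rewrite divr_gt0.
apply: le_trans (bound _ d00) _.
rewrite -EFinD lee_fin -[leRHS]lnK ?posrE ?addr_gt0// ler_expR mulrA.
rewrite /d0 mulrA ler_pdivrMr//; lra.
Qed.

End q_aggregation.

(** * Convexity and Lipschitz continuity *)

Section convexity.
Context {R : realType} (b : R) (phi : R -> R).
Hypothesis cvx : forall a a' t, -b <= a <= b -> -b <= a' <= b -> 0 < t < 1 ->
  phi (t * a + (1 - t) * a') <= t * phi a + (1 - t) * phi a'.

Lemma convex_chord u t w : -b <= u -> w <= b -> u <= t <= w ->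
  phi t * (w - u) <= phi u * (w - t) + phi w * (t - u).
Proof.
move=> bu wb /andP[]; rewrite le_eqVlt => /predU1P[<- _|ut].
  by rewrite subrr mulr0 addr0.
rewrite le_eqVlt => /predU1P[<-|tw]; first by rewrite subrr mulr0 add0r.
have wu : 0 < w - u by lra.
have s01 : 0 < (w - t) / (w - u) < 1.
  apply/andP; split; first by rewrite divr_gt0// subr_gt0.
  by rewrite ltr_pdivrMr// mul1r; lra.
have := @cvx u w _ _ _ s01; rewrite [X in phi X](_ : _ = t); last by field; rewrite lt0r_neq0.
move=> /(_ ltac:(apply/andP; split; lra) ltac:(apply/andP; split; lra)).
rewrite -(ler_pM2r wu) => /le_trans; apply.
by rewrite le_eqVlt; apply/orP; left; apply/eqP; field; rewrite lt0r_neq0.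
Qed.

(* Below the right end point b the slopes of phi are at most the slope of
   [r, b] for a rational r. *)
Lemma convex_slope_le C : (forall q : rat, -b < ratr q < b ->
    phi b - phi (ratr q) <= C * (b - ratr q)) ->
  forall u v, -b <= u -> u < v -> v <= b -> phi v - phi u <= C * (v - u).
Proof.
move=> hq u v bu uv vb; have ub : u < b by apply: lt_le_trans vb.
have [q] := rat_in_itvoo ub; rewrite in_itv/= => /andP[uq qb].
have h1 : phi b - phi (ratr q) <= C * (b - ratr q).
  by apply: hq; rewrite qb (le_lt_trans bu).
have h2 : phi (ratr q) * (b - u) <= phi u * (b - ratr q) + phi b * (ratr q - u).
  by apply: convex_chord => //; rewrite !ltW.
have h3 : phi v * (b - u) <= phi u * (b - v) + phi b * (v - u).
  by apply: convex_chord => //; rewrite vb ltW.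
have bu0 : 0 < b - u by lra.
have h4 : phi b - phi u <= C * (b - u).
  have bq0 : 0 < b - ratr q by lra.
  have h5 := ler_wpM2r (ltW bu0) h1; rewrite -(ler_pM2r bq0); lra.
have vu0 : 0 <= v - u by lra.
have h5 := ler_wpM2r vu0 h4; rewrite -(ler_pM2r bu0); lra.
Qed.

(** Induction on the list of points with an accumulated barycentre [c] of weight [w]. It starts from
    an index of positive weight, so no quotient is degenerate. *)
Lemma convex_jensen (M : nat) (th a : 'I_M -> R) : simplex th ->
  (forall j, -b <= a j <= b) ->
  phi (\sum_j th j * a j) <= \sum_j th j * phi (a j).
Proof.
move=> [th0 th1] ab.
have gen (r : seq 'I_M) (w c : R) : 0 < w -> -b <= c <= b ->
    phi ((w * c + \sum_(j <- r) th j * a j) / (w + \sum_(j <- r) th j))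
      * (w + \sum_(j <- r) th j) <= w * phi c + \sum_(j <- r) th j * phi (a j).
  elim: r w c => [|j r IH] w c w0 cb.
    by rewrite !big_nil !addr0 mulrAC mulfV ?lt0r_neq0// mul1r mulrC.
  rewrite !big_cons !addrA.
  have [tj0|tj0] := eqVneq (th j) 0; first by rewrite tj0 !mul0r !addr0; exact: IH.
  have tjp : 0 < th j by rewrite lt0r tj0 th0.
  have wt0 : 0 < w + th j by rewrite addr_gt0.
  pose c' := (w * c + th j * a j) / (w + th j).
  have /andP[c1 c2] := cb; have /andP[a1 a2] := ab j.
  have cb' : -b <= c' <= b.
    rewrite /c' ler_pdivlMr// ler_pdivrMr//; apply/andP; split.
      have := ler_wpM2l (ltW w0) c1; have := ler_wpM2l (ltW tjp) a1; lra.
    have := ler_wpM2l (ltW w0) c2; have := ler_wpM2l (ltW tjp) a2; lra.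
  have := IH _ _ wt0 cb'.
  rewrite [(w + th j) * c'](_ : _ = w * c + th j * a j); last first.
    by rewrite /c' mulrC divfK// lt0r_neq0.
  move=> /le_trans; apply; rewrite lerD2r.
  have s01 : 0 < w / (w + th j) < 1.
    by apply/andP; split; [rewrite divr_gt0|rewrite ltr_pdivrMr// mul1r ltrDl].
  have := cvx cb (ab j) s01.
  rewrite [X in phi X](_ : _ = c'); last by rewrite /c'; field; rewrite lt0r_neq0.
  rewrite -(ler_pM2l wt0) => /le_trans; apply.
  by rewrite le_eqVlt; apply/orP; left; apply/eqP; field; rewrite lt0r_neq0.
have [j tj] : exists j, 0 < th j.
  apply: contrapT => /forallNP h.
  have : \sum_j th j <= 0.
    by apply: sumr_le0 => j _; rewrite leNgt; apply/negP; exact: h.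
  by rewrite th1 ler10.
have E (u : 'I_M -> R) :
    u j + \sum_(k <- [seq k <- index_enum 'I_M | k != j]) u k = \sum_k u k.
  by rewrite big_filter [RHS](bigD1 j).
have := gen [seq k <- index_enum 'I_M | k != j] _ _ tj (ab j).
rewrite (E (fun k => th k * a k)) (E (fun k => th k * phi (a k))) (E th).
by rewrite th1 divr1 mulr1.
Qed.

End convexity.

(** The slopes of a convex function are extremal at the end points of the interval. Lower bounds on
    slopes follow from upper bounds by the reflection [x |-> - x]. *)
Lemma convex_lipschitz {R : realType} (b C : R) (phi : R -> R) :
  (forall a a' t, -b <= a <= b -> -b <= a' <= b -> 0 < t < 1 ->
    phi (t * a + (1 - t) * a') <= t * phi a + (1 - t) * phi a') ->
  (forall q : rat, -b < ratr q < b ->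
    phi b - phi (ratr q) <= C * (b - ratr q) /\
    phi (- b) - phi (ratr q) <= C * (b + ratr q)) ->
  forall u v, -b <= u <= b -> -b <= v <= b -> `|phi u - phi v| <= C * `|u - v|.
Proof.
move=> cvx hq.
have H u v : -b <= u -> u < v -> v <= b -> `|phi u - phi v| <= C * `|u - v|.
  move=> bu uv vb.
  have h1 : phi v - phi u <= C * (v - u).
    by apply: (convex_slope_le cvx) => // q /hq[].
  have h2 : phi u - phi v <= C * (v - u).
    have cvx' a a' t : -b <= a <= b -> -b <= a' <= b -> 0 < t < 1 ->
        phi (- (t * a + (1 - t) * a')) <= t * phi (- a) + (1 - t) * phi (- a').
      move=> ha ha' ht.
      rewrite (_ : - _ = t * (- a) + (1 - t) * (- a')); last by ring.
      by apply: cvx => //; rewrite lerNl opprK lerNl andbC.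
    have hq' (q : rat) : -b < ratr q < b ->
        phi (- b) - phi (- ratr q) <= C * (b - ratr q).
      move=> /andP[q1 q2]; have /hq[_] : -b < ratr (- q) < b.
        by rewrite rmorphN/= ltrN2 q2 ltrNl q1.
      by rewrite rmorphN.
    have k1 : -b <= - v by rewrite lerN2.
    have k2 : - v < - u by rewrite ltrN2.
    have k3 : - u <= b by rewrite lerNl.
    have := convex_slope_le cvx' hq' k1 k2 k3; rewrite !opprK; lra.
  have vu0 : 0 <= v - u by lra.
  rewrite [`|u - v|]distrC (ger0_norm vu0).
  by rewrite ler_norml; apply/andP; split; lra.
move=> u v /andP[u1 u2] /andP[v1 v2]; have [uv|uv|->] := ltgtP u v.
- exact: H.
- by rewrite distrC [X in _ * X]distrC; exact: H.
- by rewrite !subrr !normr0 mulr0.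
Qed.

(* Evaluate the modulus of convexity between the end points at the points
   4b/5 and -4b/5. *)
Lemma strongly_convex_lipschitz_le {R : realType} (b C Cl : R) (phi : R -> R) :
  0 < b ->
  (forall a a' t, -b <= a <= b -> -b <= a' <= b -> 0 < t < 1 ->
    phi (t * a + (1 - t) * a')
      <= t * phi a + (1 - t) * phi a' - Cl / 2 * t * (1 - t) * (a - a') ^+ 2) ->
  (forall u v, -b <= u <= b -> -b <= v <= b -> `|phi u - phi v| <= C * `|u - v|) ->
  9 * Cl * b <= 10 * C.
Proof.
move=> b0 cvx lip.
have bb : -b <= b <= b by apply/andP; split; lra.
have bb' : -b <= - b <= b by apply/andP; split; lra.
have t01 : 0 < (1 / 10 : R) < 1 by lra.
have h1 := cvx _ _ _ bb bb' t01; have h2 := cvx _ _ _ bb' bb t01.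
have p1 : -b <= 1 / 10 * b + (1 - 1 / 10) * - b <= b by apply/andP; split; lra.
have p2 : -b <= 1 / 10 * - b + (1 - 1 / 10) * b <= b by apply/andP; split; lra.
have k1 := lip _ _ p1 bb'; have k2 := lip _ _ p2 bb.
have e1 : `|1 / 10 * b + (1 - 1 / 10) * - b - - b| = b / 5 by rewrite ger0_norm; lra.
have e2 : `|1 / 10 * - b + (1 - 1 / 10) * b - b| = b / 5 by rewrite ler0_norm; lra.
rewrite e1 in k1; rewrite e2 in k2.
move: k1 k2; rewrite !ler_norml => /andP[k1 _] /andP[k2 _].
by rewrite -(ler_pM2r b0); lra.
Qed.

(** The exceptional null set of the hypothesis depends on the pair [u], [v]. Only countably many
    pairs, an end point and a rational, are merged into one null set, and convexity extends the
    bound to all pairs. *)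
Lemma ae_lipschitz {R : realType} d (T : measurableType d) (mu : {measure set T -> \bar R})
    (b C : R) (phi : T -> R -> R) : 0 < b ->
  (forall u v, -b <= u <= b -> -b <= v <= b ->
     \forall z \ae mu, `|phi z u - phi z v| <= C * `|u - v|) ->
  (\forall z \ae mu, forall a a' t, -b <= a <= b -> -b <= a' <= b -> 0 < t < 1 ->
    phi z (t * a + (1 - t) * a') <= t * phi z a + (1 - t) * phi z a') ->
  \forall z \ae mu, forall u v, -b <= u <= b -> -b <= v <= b ->
    `|phi z u - phi z v| <= C * `|u - v|.
Proof.
move=> b0 lip cvx.
have bb : -b <= b <= b by apply/andP; split; lra.
have bb' : -b <= - b <= b by apply/andP; split; lra.
have lipq : \forall z \ae mu, forall k : nat, forall q : rat,
    unpickle k = Some q -> -b < ratr q < b ->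
    phi z b - phi z (ratr q) <= C * (b - ratr q) /\
    phi z (- b) - phi z (ratr q) <= C * (b + ratr q).
  apply: ae_foralln => k; case: (unpickle k) => [q|]; last exact: aeW.
  have [/andP[q1 q2]|nq] := boolP ((-b < (ratr q : R)) && (ratr q < b)); last first.
    by apply: aeW => z _ [<-]; rewrite (negbTE nq).
  have qb : -b <= ratr q <= b by rewrite !ltW.
  apply: filterS2 (lip _ _ bb qb) (lip _ _ bb' qb) => z h1 h2 _ [<-] _.
  have d1 : 0 <= b - ratr q by lra.
  have d2 : - b - ratr q <= 0 by lra.
  move: h1 h2; rewrite (ger0_norm d1) (ler0_norm d2).
  rewrite !ler_norml => /andP[_ h1] /andP[_ h2]; split; lra.
apply: filterS2 lipq cvx => z hq hc; apply: convex_lipschitz => // q.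
by apply: (hq (pickle q)); rewrite pickleK.
Qed.

(** * From the exponential moment to deviation and expectation *)

Section chernoff.
Context {R : realType} d (Omega : measurableType d) (P : probability Omega R).
Variable Y : Omega -> R.
Hypothesis bY : bmeas Y.
Hypothesis Y1 : (\int[P]_w (expR (Y w))%:E <= 1)%E.

Lemma chernoff_le (x : R) : ((1 - expR (- x))%:E <= P [set w | (Y w <= x)%R])%E.
Proof.
have mA : measurable [set w | Y w <= x].
  have := bY.1 measurableT `]-oo, x]%classic (measurable_itv _).
  have E : Y @^-1` `]-oo, x]%classic = [set w | Y w <= x].
    by apply/seteqP; split => w /=; rewrite in_itv.
  by rewrite setTI E.
set A := [set _ | _] in mA *.
have PC : (P (~` A) <= (expR (- x))%:E)%E.
  have e0 : (0 <= (expR (- x))%:E :> \bar R)%E by rewrite lee_fin expR_ge0.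
  have mY : measurable_fun setT (fun w => (expR (Y w))%:E).
    by apply/measurable_EFinP; exact: (bmeas_expR bY).1.
  have : ((expR x)%:E * P (~` A) <= 1)%E.
    apply: le_trans Y1; rewrite -integral_cst; last exact: measurableC.
    apply: (@le_trans _ _ (\int[P]_(w in ~` A) (expR (Y w))%:E)%E).
      apply: ge0_le_integral => //.
      - exact: measurableC.
      - by move=> w _; rewrite lee_fin expR_ge0.
      - exact: measurable_funS mY.
      - move=> w /= /negP; rewrite -ltNge => /ltW xw.
        by rewrite lee_fin ler_expR.
    by apply: ge0_subset_integral => //; exact: measurableC.
  move=> /(lee_wpmul2l e0); rewrite mule1 muleA -EFinM -expRD addNr expR0 mul1e.
  exact.
have -> : P A = (1 - P (~` A))%E.
  by rewrite -probability_setC ?setCK//; exact: measurableC.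
by rewrite EFinB leeB.
Qed.

Lemma mean_le0 : \int[P]_w Y w <= 0.
Proof.
rewrite -ler_expR expR0 (le_trans (expR_jensen P bY))//.
by rewrite -lee_fin -bmeas_RintegralE//; exact: bmeas_expR.
Qed.

End chernoff.

(** * Reduction of the oracle inequalities to bounded functions *)

Unset Implicit Arguments.

Theorem theorem1
  (R : realType) (dX dO : measure_display)
  (X : measurableType dX) (Omega : measurableType dO)
  (P : probability Omega R)
  (law : probability (X * R)%type R)   (* distribution of (X, Y) *)
  (n M : nat) (Z : 'I_n -> Omega -> X * R)   (* the data D = (X_i, Y_i)_i *)
  (f : 'I_M -> X -> R)                 (* the dictionary *)
  (l : R -> R -> R)                    (* the loss *)
  (b Cb Cl nu beta mu : R) (pi : 'I_M -> R)
  (thetahat : Omega -> 'I_M -> R) :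
  (0 < n)%N ->
  iid_sample P law Z ->
  0 < b ->
  (\forall z \ae law, `|z.2| <= b) ->
  (forall j, measurable_fun setT (f j)) ->
  (\forall z \ae law, forall j, `|f j z.1| <= b) ->
  (* regularity making the risks well defined and finite *)
  measurable_fun setT (fun p : R * R => l p.1 p.2) ->
  (forall j, law.-integrable setT (fun z => (l z.2 (f j z.1))%:E)) ->
  (* Assumption 1 *)
  (forall u v, -b <= u <= b -> -b <= v <= b ->
     \forall z \ae law, `|l z.2 u - l z.2 v| <= Cb * `|u - v|) ->
  0 < Cl ->
  (\forall z \ae law, forall a a' alpha, -b <= a <= b -> -b <= a' <= b ->
     0 < alpha < 1 ->
     l z.2 (alpha * a + (1 - alpha) * a')
       <= alpha * l z.2 a + (1 - alpha) * l z.2 a'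
          - Cl / 2 * alpha * (1 - alpha) * (a - a') ^+ 2) ->
  0 < nu < 1 ->
  (forall j, 0 < pi j) -> \sum_(j < M) pi j = 1 ->
  mu = Num.min nu (1 - nu) * Cl / 10 ->
  Num.max (Num.max (12 * Cb ^+ 2 * (1 - nu) ^+ 2 / mu)
                   (6 * Num.sqrt 3 * b * Cb * (1 - nu)))
          (3 * Cb * nu * (nu * Cb + 4 * mu * b) / (2 * mu)) < beta ->
  (* thetahat is a measurable Q-aggregation minimizer over the simplex *)
  (forall j, measurable_fun setT (fun w => thetahat w j)) ->
  (forall w, simplex (thetahat w) /\
     forall theta, simplex theta ->
       Qcrit (fun i => Z i w) l f nu beta pi (thetahat w)
         <= Qcrit (fun i => Z i w) l f nu beta pi theta) ->
  (forall x : R, 0 < x ->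
     ((1 - expR (- x))%:E <=
      P [set w | (risk law l (mix f (thetahat w))
                  <= \big[Order.min/+oo]_(j < M)
                       (risk law l (f j) + (beta / n%:R * ln (pi j)^-1)%:E)
                     + (2 * beta * x / n%:R)%:E)%E])%E)
  /\
  (\int[P]_w risk law l (mix f (thetahat w))
     <= \big[Order.min/+oo]_(j < M)
          (risk law l (f j) + (beta / n%:R * ln (pi j)^-1)%:E))%E.
Proof.
move=> n0 iidZ b0 _ mf aef ml intl lip Cl0 scvx nu01 pi0 pi1 muE betaH mth minth.
have /andP[nu0 nu1] := nu01.
(* The prior sums to 1, so the dictionary is not empty; [f j0] becomes the reference whose loss is
   subtracted. *)
have [j0 _] : exists j : 'I_M, True.
  apply: contrapT => /forallNP h; have : \sum_(j < M) pi j = 0.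
    by rewrite big1// => j; case: (h j I).
  by rewrite pi1 => /eqP; rewrite oner_eq0.
have aecvx : \forall z \ae law, forall a a' t, -b <= a <= b -> -b <= a' <= b ->
    0 < t < 1 -> l z.2 (t * a + (1 - t) * a') <= t * l z.2 a + (1 - t) * l z.2 a'.
  apply: filterS scvx => z hz a a' t ha ha' t01.
  apply: le_trans (hz _ _ _ ha ha' t01) _; rewrite gerBl; have /andP[t0 t1] := t01.
  by rewrite mulr_ge0 ?sqr_ge0// mulr_ge0 ?subr_ge0 1?ltW// mulr_gt0// divr_gt0.
have aelip := ae_lipschitz (phi := fun z : X * R => l z.2) b0 lip aecvx.
have [N [mN N0 goodN]] : exists N, [/\ measurable N, law N = 0%E & forall z, ~ N z ->
    [/\ forall j, `|f j z.1| <= b,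
        forall u v, -b <= u <= b -> -b <= v <= b ->
          `|l z.2 u - l z.2 v| <= Cb * `|u - v| &
        forall a a' t, -b <= a <= b -> -b <= a' <= b -> 0 < t < 1 ->
          l z.2 (t * a + (1 - t) * a') <= t * l z.2 a + (1 - t) * l z.2 a'
            - Cl / 2 * t * (1 - t) * (a - a') ^+ 2]].
  have [N [mN N0 sub]] := filterI (filterI aef aelip) scvx.
  exists N; split => // z Nz.
  suff [[h1 h2] h3] : ([set z | forall j, `|f j z.1| <= b] `&`
    [set z : X * R | forall u v, -b <= u <= b -> -b <= v <= b ->
          `|l z.2 u - l z.2 v| <= Cb * `|u - v|] `&`
    [set z : X * R | forall a a' t, -b <= a <= b -> -b <= a' <= b -> 0 < t < 1 ->
          l z.2 (t * a + (1 - t) * a') <= t * l z.2 a + (1 - t) * l z.2 a'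
            - Cl / 2 * t * (1 - t) * (a - a') ^+ 2]) z by split.
  by apply: contrapT => h; apply: Nz; exact: sub.
(* One point off the null set is enough to derive the deterministic relation between [Cl], [b] and
   [Cb]. *)
have [z0 Nz0] : exists z, ~ N z.
  apply: contrapT => /forallNP h; have NT : N = setT.
    by apply/seteqP; split => // z _; exact: contrapT (h z).
  have := probability_setT law; rewrite -NT N0 => /eqP.
  by rewrite eqe eq_sym oner_eq0.
have ClCb : 9 * Cl * b <= 10 * Cb.
  have [_ h2 h3] := goodN _ Nz0.
  exact: (strongly_convex_lipschitz_le b0 h3 h2).
have Cb0 : 0 < Cb by have Clb := mulr_gt0 Cl0 b0; lra.
have nu1' : 0 < 1 - nu by rewrite subr_gt0.
have mu0 : 0 < mu by rewrite muE divr_gt0// mulr_gt0// lt_min nu0.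
have hmu1 : 5 * mu <= nu * (Cl / 2).
  have : Num.min nu (1 - nu) * Cl <= nu * Cl by rewrite ler_wpM2r ?ge_min ?lexx// ltW.
  by rewrite muE; lra.
have hmu2 : 5 * mu <= (1 - nu) * (Cl / 2).
  have : Num.min nu (1 - nu) * Cl <= (1 - nu) * Cl.
    by rewrite ler_wpM2r ?ge_min ?lexx ?orbT// ltW.
  by rewrite muE; lra.
move: betaH; rewrite !gt_max => /andP[/andP[hA _] hB].
rewrite ltr_pdivrMr// in hA; rewrite ltr_pdivrMr ?mulr_gt0// in hB.
have beta0 : 0 < beta.
  rewrite -(pmulr_lgt0 beta mu0); apply: le_lt_trans hA.
  by apply: mulr_ge0; [apply: mulr_ge0 => //|]; exact: sqr_ge0.
have hA1 : 12 * Cb ^+ 2 * (1 - nu) ^+ 2 <= mu * beta by rewrite [leRHS]mulrC ltW.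
(* 108 is 12 * 9: one factor [(1 - nu) * Cb] of [hA1] is bounded below by [9 * mu * b]. *)
have hA2 : 108 * b * Cb * (1 - nu) <= beta.
  have h1 : 9 * mu * b <= (1 - nu) * Cb.
    have k1 := ler_wpM2r (ltW b0) hmu2; have k2 := ler_wpM2l (ltW nu1') ClCb; lra.
  have h2 := ler_wpM2l (ltW (mulr_gt0 Cb0 nu1')) h1.
  by rewrite -(ler_pM2l mu0); lra.
have hB1 : 3 * Cb * nu * (nu * Cb + 4 * mu * b) <= 2 * mu * beta.
  by rewrite [leRHS]mulrC ltW.
have beta_n : 0 < n%:R / beta by rewrite divr_gt0// ltr0n.
pose kap j := ln (pi j)^-1.
have kapE j : kap j = - ln (pi j) by rewrite /kap lnV// posrE.
have kap1 : \sum_j expR (- kap j) = 1.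
  by rewrite -[RHS]pi1; apply: eq_bigr => j _; rewrite kapE opprK lnK// posrE.
(* Discarding a null set, all the assumptions on (X, Y) hold pointwise, and
   the loss is bounded once the loss of f_j0 has been subtracted. *)
pose ind (z : X * R) : R := \1_(~` N) z.
have ind1 z : ~ N z -> ind z = 1 by move=> Nz; rewrite /ind indicE mem_set.
have ind0 z : N z -> ind z = 0.
  by move=> Nz; rewrite /ind indicE memNset//= => /(_ Nz).
have mind : measurable_fun setT ind.
  by apply: measurable_indic; exact: measurableC.
pose F j (z : X * R) := ind z * f j z.1.
pose D th (z : X * R) := ind z * (l z.2 (mix f th z.1) - l z.2 (f j0 z.1)).
have mixF th z : mix F th z = ind z * mix f th z.1.
  by rewrite /mix mulr_sumr; apply: eq_bigr => j _; rewrite mulrCA.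
have D0 th z : N z -> D th z = 0 by move=> /ind0 iz; rewrite /D iz mul0r.
have F0 th z : N z -> mix F th z = 0 by move=> /ind0 iz; rewrite mixF iz mul0r.
have D1 th z : ~ N z -> D th z = l z.2 (mix f th z.1) - l z.2 (f j0 z.1).
  by move=> /ind1 iz; rewrite /D iz mul1r.
have F1 th z : ~ N z -> mix F th z = mix f th z.1.
  by move=> /ind1 iz; rewrite mixF iz mul1r.
have mixb th z : simplex th -> ~ N z -> -b <= mix f th z.1 <= b.
  move=> sth /goodN[hf _ _]; rewrite -ler_norml.
  exact: simplex_norm_sum_le.
have vf j : mix f (vertex j) = f j by apply/funext => x; rewrite /mix sum_vertex.
have fb j z : ~ N z -> -b <= f j z.1 <= b by move=> /goodN[hf _ _]; rewrite -ler_norml.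
(* Joint measurability in the weights and the observation: it is applied to constant weights for
   [mD] and to the random [thetahat] for [mmean]. *)
have mmix_gen d' (U : measurableType d') (t : 'I_M -> U -> R) (z : U -> X * R) :
    (forall j, measurable_fun setT (t j)) -> measurable_fun setT z ->
    measurable_fun setT (fun u => D (t ^~ u) (z u)).
  move=> mt mz.
  have mz1 : measurable_fun setT (fun u => (z u).1) by exact: measurableT_comp measurable_fst mz.
  have mz2 : measurable_fun setT (fun u => (z u).2) by exact: measurableT_comp measurable_snd mz.
  have mfz j : measurable_fun setT (fun u => f j (z u).1) by exact: measurableT_comp (mf j) mz1.
  have mlz (g : U -> R) : measurable_fun setT g -> measurable_fun setT (fun u => l (z u).2 (g u)).
    move=> mg; apply: (measurableT_comp (f := fun p : R * R => l p.1 p.2)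
      (g := fun u => ((z u).2, g u))) => //.
    exact/measurable_fun_pairP.
  apply: measurable_funM; first exact: measurableT_comp mind mz.
  apply: measurable_funB; last exact: mlz.
  by apply: mlz; apply: measurable_sum => j; exact: measurable_funM.
have mD th : simplex th -> measurable_fun setT (D th).
  by move=> _; exact: (@mmix_gen _ _ (fun j _ => th j) (fun z => z)).
have mF j : measurable_fun setT (F j).
  apply: measurable_funM => //.
  exact: measurableT_comp (mf j) measurable_fst.
have Fb j z : `|F j z| <= b.
  have [Nz|Nz] := pselect (N z); first by rewrite /F ind0// mul0r normr0 ltW.
  by rewrite /F ind1// mul1r; have [] := goodN _ Nz.
have lipD th th' z : simplex th -> simplex th' ->
    `|D th z - D th' z| <= Cb * `|mix F th z - mix F th' z|.
  move=> sth sth'; have [Nz|Nz] := pselect (N z).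
    by rewrite !D0// !F0// !subrr !normr0 mulr0.
  rewrite !D1// !F1// opprB addrA subrK.
  by have [_ h _] := goodN _ Nz; apply: h; exact: mixb.
have Db th z : simplex th -> `|D th z| <= 2 * Cb * b.
  move=> sth; have [Nz|Nz] := pselect (N z).
    by rewrite D0// normr0 !mulr_ge0// ltW.
  rewrite D1//; have [hf h _] := goodN _ Nz.
  apply: le_trans (h _ _ (mixb _ _ sth Nz) (fb j0 z Nz)) _.
  rewrite [leRHS](_ : _ = Cb * (b + b)); last by ring.
  apply: ler_wpM2l; first exact: ltW.
  by apply: le_trans (ler_normB _ _) _; apply: lerD; rewrite ler_norml; [exact: mixb|exact: fb].
have cvxD th th' (a : R) z : simplex th -> simplex th' -> 0 < a < 1 ->
    D (fun j => a * th j + (1 - a) * th' j) z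
    <= a * D th z + (1 - a) * D th' z
       - Cl / 2 * a * (1 - a) * (mix F th z - mix F th' z) ^+ 2.
  move=> sth sth' a01; have [Nz|Nz] := pselect (N z).
    by rewrite !(D0 _ _ Nz) !(F0 _ _ Nz); lra.
  rewrite !D1// !F1// mix_convex; have [_ _ h] := goodN _ Nz.
  have := h _ _ _ (mixb _ _ sth Nz) (mixb _ _ sth' Nz) a01; lra.
have cvxN th z : simplex th ->
    D th z <= \sum_j th j * D (vertex j) z - Cl / 2 * spread F th z.
  move=> sth; have [Nz|Nz] := pselect (N z).
    rewrite /spread D0// F0// big1 => [|j _]; last by rewrite D0// mulr0.
    rewrite big1 => [|j _]; last by rewrite /F ind0// mul0r expr0n/= mulr0.
    by rewrite expr0n/= subrr mulr0 subrr.
  have [_ _ h] := goodN _ Nz.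
  (* Subtracting [Cl / 2 * a ^+ 2] leaves a convex function; Jensen's inequality for it returns the
     spread as the gap. *)
  have cvx' a a' t : -b <= a <= b -> -b <= a' <= b -> 0 < t < 1 ->
      l z.2 (t * a + (1 - t) * a') - Cl / 2 * (t * a + (1 - t) * a') ^+ 2
      <= t * (l z.2 a - Cl / 2 * a ^+ 2) + (1 - t) * (l z.2 a' - Cl / 2 * a' ^+ 2).
    by move=> ha ha' t01; have := h _ _ _ ha ha' t01; lra.
  have := convex_jensen cvx' sth (fun j => fb j z Nz).
  rewrite -/(mix f th z.1) /spread F1// D1//.
  rewrite [X in _ <= X -> _](eq_bigr (fun j => th j * l z.2 (f j z.1)
    - Cl / 2 * (th j * f j z.1 ^+ 2))); last by move=> j _; ring.
  rewrite sumrB -mulr_sumr => hj.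
  rewrite [X in _ <= X - _](eq_bigr (fun j => th j * l z.2 (f j z.1)
    - th j * l z.2 (f j0 z.1))); last by move=> j _; rewrite D1// vf; ring.
  rewrite sumrB simplex_sum_cst//.
  rewrite [X in _ * (X - _)](eq_bigr (fun j => th j * f j z.1 ^+ 2)); last first.
    by move=> j _; rewrite /F ind1// mul1r.
  by rewrite -/(mix f th z.1); lra.
pose obj := qobj law n F D nu mu beta kap.
have [thS [sS hS]] : exists th, simplex th /\ forall th', simplex th' -> obj th <= obj th'.
  have [L hL] := @qobj_lip _ _ _ law M n F D b Cb nu mu beta kap b0 Cb0 nu01 mu0 beta0
    mF Fb mD Db lipD.
  exact: (simplex_argmin (simplex_vertex j0) hL).
have sH w : simplex (thetahat w) by have [] := minth w.
have mmean : measurable_fun setT (fun w => mean law (D (thetahat w))).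
  pose c := 2 * Cb * b.
  have bDth th : simplex th -> bmeas (D th).
    by move=> sth; split; [exact: mD|exists c => z; exact: Db].
  (* Adding [c] makes the integrand nonnegative, so that Tonelli gives measurability in [w]. *)
  have -> : (fun w => mean law (D (thetahat w)))
      = (fun w => fine (\int[law]_z (D (thetahat w) z + c)%:E)%E - c).
    apply/funext => w; rewrite -/(Rintegral _ _ _) bmeas_RintegralD//.
    - by rewrite Rintegral_prob_cst addrK.
    - exact: bDth.
    - exact: bmeas_cst.
  apply: measurable_funB => //; apply: (measurableT_comp (@fine_measurable R _ measurableT)).
  have m12 : measurable_fun setT
      (fun p : Omega * (X * R) => (D (thetahat p.1) p.2 + c)%:E).
    apply/measurable_EFinP; apply: measurable_funD => //.
    apply: (@mmix_gen _ _ (fun j p => thetahat p.1 j) (fun p => p.2)).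
      by move=> j; exact: measurableT_comp (mth j) measurable_fst.
    exact: measurable_snd.
  have := measurable_fun_fubini_tonelli_F (m2 := law) _ m12; apply => p.
  have := Db _ p.2 (sH p.1); rewrite ler_norml lee_fin => /andP[? _].
  by rewrite -lerBlDr sub0r.
have aeZ : \forall w \ae P, forall i, ~ N (Z i w).
  apply: filter_forall => i; exists (Z i @^-1` N); split.
  - by rewrite -[X in measurable X]setTI; exact: (iidZ.1 i).
  - by rewrite iidZ.2.1.
  - by move=> w /= /contrapT.
have emp : \forall w \ae P,
    n%:R^-1 * \sum_(i < n) qloss D nu (thetahat w) (Z i w)
      + beta / n%:R * prior_pen kap (thetahat w)
    <= n%:R^-1 * \sum_(i < n) qloss D nu thS (Z i w) + beta / n%:R * prior_pen kap thS.
  apply: filterS aeZ => w hw.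
  (* The two criteria differ by the empirical loss of [f j0], which does not depend on [th], so they
     have the same minimizers. *)
  have QE th : simplex th -> n%:R^-1 * \sum_(i < n) qloss D nu th (Z i w)
      + beta / n%:R * prior_pen kap th
    = Qcrit (fun i => Z i w) l f nu beta pi th
      - n%:R^-1 * \sum_(i < n) l (Z i w).2 (f j0 (Z i w).1).
    move=> sth; rewrite /Qcrit /emp_risk /prior_pen.
    have -> : \sum_(j < M) th j * kap j = - \sum_(j < M) th j * ln (pi j).
      by rewrite -sumrN; apply: eq_bigr => j _; rewrite kapE mulrN.
    have -> : \sum_(i < n) qloss D nu th (Z i w) =
      (1 - nu) * (\sum_(i < n) l (Z i w).2 (mix f th (Z i w).1))
      + nu * (\sum_j th j * \sum_(i < n) l (Z i w).2 (f j (Z i w).1))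
      - \sum_(i < n) l (Z i w).2 (f j0 (Z i w).1).
      rewrite (eq_bigr (fun j => \sum_(i < n) th j * l (Z i w).2 (f j (Z i w).1))); last first.
        by move=> j _; rewrite mulr_sumr.
      rewrite exchange_big/= !mulr_sumr -big_split/= -sumrB; apply: eq_bigr => i _.
      rewrite /qloss D1//.
      rewrite (eq_bigr (fun j => th j * l (Z i w).2 (f j (Z i w).1)
        - th j * l (Z i w).2 (f j0 (Z i w).1))); last by move=> j _; rewrite D1// vf; ring.
      by rewrite sumrB simplex_sum_cst//; ring.
    rewrite [X in _ = _ + nu * X - _ - _](_ : _ =
      n%:R^-1 * \sum_j th j * \sum_(i < n) l (Z i w).2 (f j (Z i w).1)); first by ring.
    by rewrite mulr_sumr; apply: eq_bigr => j _; rewrite mulrCA.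
  rewrite !QE// lerB//; have [_ ->] := minth w; by [].
have moment := exp_excess_risk_le1 b0 Cb0 nu01 mu0 beta0 n0 mF Fb mD Db lipD cvxD cvxN
  hmu1 hmu2 iidZ kap1 hA1 hA2 hB1 sS hS sH mmean emp.
have bmean : bmeas (fun w => mean law (D (thetahat w))).
  split => //; exists (2 * Cb * b) => w.
  have bDw : bmeas (D (thetahat w)).
    by split; [exact: mD|exists (2 * Cb * b) => z; exact: Db].
  rewrite ler_norml -[- _](Rintegral_prob_cst law) -{2}[2 * Cb * b](Rintegral_prob_cst law).
  apply/andP; split; apply: bmeas_le_Rintegral => //; try exact: bmeas_cst;
    by move=> z; have := Db _ z (sH w); rewrite ler_norml => /andP[].
pose Y w := n%:R / beta * (mean law (D (thetahat w)) - obj thS).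
have bY : bmeas Y by apply/bmeasZ/bmeasB => //; exact: bmeas_cst.
pose r0 := \int[law]_z l z.2 (f j0 z.1).
have riskE th : simplex th -> risk law l (mix f th) = (r0 + mean law (D th))%:E.
  move=> sth; have iD : law.-integrable setT (EFin \o D th).
    by apply: bmeas_integrable; split; [exact: mD|exists (2 * Cb * b) => z; exact: Db].
  have mmixf : measurable_fun setT (fun z : X * R => l z.2 (mix f th z.1)).
    apply: (measurableT_comp (f := fun p : R * R => l p.1 p.2)
      (g := fun z : X * R => (z.2, mix f th z.1))) => //.
    apply/measurable_fun_pairP; split; first exact: measurable_snd.
    apply: measurable_sum => j; apply: measurable_funM => //.
    exact: measurableT_comp (mf j) measurable_fst.
  have i0 := intl j0.
  rewrite /risk (ae_eq_integral (fun z => (l z.2 (f j0 z.1))%:E + (D th z)%:E)%E)//.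
  - rewrite integralD_EFin// EFinD /r0 /mean /Rintegral !fineK//; exact: integrable_fin_num.
  - exact/measurable_EFinP.
  - apply: emeasurable_funD; first by case/integrableP: i0.
    by apply/measurable_EFinP; exact: mD.
  - exists N; split => // z /= hz; apply: contrapT => Nz; apply: hz => _.
    by rewrite D1// -EFinD addrC subrK.
(* At a vertex the spread vanishes and [qloss] reduces to [D], so the objective there is the
   penalized risk of [f j], up to [r0]. *)
have oracle : ((r0 + obj thS)%:E <= \big[Order.min/+oo]_(j < M)
    (risk law l (f j) + (beta / n%:R * ln (pi j)^-1)%:E))%E.
  apply: le_bigmin => [|j _]; first exact: leey.
  rewrite -vf riskE; last exact: simplex_vertex.
  rewrite -EFinD lee_fin -addrA lerD2l.
  apply: le_trans (hS _ (simplex_vertex j)) _.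
  rewrite /obj /qobj /prior_pen sum_vertex lerD2r le_eqVlt; apply/orP; left; apply/eqP.
  apply: eq_Rintegral => z _; rewrite /qloss /spread sum_vertex sum_vertex.
  by rewrite /mix sum_vertex; ring.
split=> [x x0|].
  have := chernoff_le bY moment x => /le_trans; apply.
  apply: le_measure; rewrite ?inE.
  - rewrite -[X in measurable X]setTI.
    have := bY.1 measurableT `]-oo, x]%classic (measurable_itv _).
    have -> : Y @^-1` `]-oo, x]%classic = [set w | Y w <= x].
      by apply/seteqP; split => w /=; rewrite in_itv.
    by [].
  - have mr : measurable_fun setT (fun w => risk law l (mix f (thetahat w))).
      under eq_fun do rewrite riskE//.
      by apply/measurable_EFinP; exact: measurable_funD.
    rewrite -[X in measurable X]setTI; exact: emeasurable_fun_infty_c.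
  move=> w /=; rewrite /Y => hx; rewrite riskE//.
  apply: (@le_trans _ _ ((r0 + obj thS)%:E + (2 * beta * x / n%:R)%:E)%E); last first.
    exact: leeD2r.
  rewrite -EFinD lee_fin -addrA lerD2l -lerBlDl -(ler_pM2l beta_n) (le_trans hx)//.
  have nn : n%:R != 0 :> R by rewrite pnatr_eq0 -lt0n.
  (* On the scale of [Y] the claimed deviation is [2 * x], which exceeds the threshold [x] of the
     event. *)
  rewrite (_ : n%:R / beta * (2 * beta * x / n%:R) = 2 * x); last first.
    by field; rewrite nn lt0r_neq0.
  by rewrite mulr2n mulrDl mul1r lerDl ltW.
apply: le_trans oracle; under eq_integral do rewrite riskE//.
have bc : bmeas (fun w => r0 + mean law (D (thetahat w))).
  by apply: bmeasD => //; exact: bmeas_cst.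
rewrite bmeas_RintegralE// lee_fin bmeas_RintegralD//; last exact: bmeas_cst.
rewrite Rintegral_prob_cst lerD2l -subr_le0.
have := mean_le0 bY moment; rewrite /Y bmeas_RintegralZ; last first.
  by apply: bmeasB => //; exact: bmeas_cst.
rewrite bmeas_RintegralB//; last exact: bmeas_cst.
by rewrite Rintegral_prob_cst pmulr_rle0.
Qed.
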